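(* Let $n\ge2$, $t=n(n-1)/2$, and let $G$ be a subgroup of finite index in $\mathrm{SL}_n(\mathbb{Z})$. Let $D$ be a torsionfree normal subgroup of $G$ of finite index, let $z_D\in Sh_t\otimes_D\mathbb{Q}$ be a sharbly cycle for $D$ constructed as in the context, and let $z_G=[G:D]^{-1}\iota(z_D)\in Sh_t\otimes_G\mathbb{Q}$, which is a cycle. Then $z_G$ represents a nonzero class in $H_t(G,St)$.
   Context: **Steinberg module.** $St=\widetilde H_{n-2}(T_n,\mathbb{Q})$, where $T_n$ is the Tits building of $\mathbb{Q}^n$ (the simplicial complex of flags of proper nonzero subspaces of $\mathbb{Q}^n$). **Sharbly complex.** Put $d=n(n+1)/2=n+t$. For $k\ge0$, $Sh_k$ is the $\mathbb{Q}$-vector space generated by symbols $[v_1,\dots,v_{n+k}]$ (called basic sharblies), with $v_i$ nonzero column vectors in $\mathbb{Q}^n$, modulo the relations: (i) $[v_{\sigma(1)},\dots,v_{\sigma(n+k)}]=\mathrm{sign}(\sigma)[v_1,\dots,v_{n+k}]$ for all permutations $\sigma$; (ii) $[v_1,\dots,v_{n+k}]=0$ if the $v_i$ do not span $\mathbb{Q}^n$; (iii) $[v_1,v_2,\dots,v_{n+k}]=[av_1,v_2,\dots,v_{n+k}]$ for all $a\in\mathbb{Q}^\times$. The group $\mathrm{GL}_n(\mathbb{Q})$ acts by $g[v_1,\dots,v_{n+k}]=[gv_1,\dots,gv_{n+k}]$. The boundary $\partial:Sh_k\to Sh_{k-1}$ is $\partial[v_1,\dots,v_{n+k}]=\sum_{i}(-1)^{i+1}[v_1,\dots,\widehat{v_i},\dots,v_{n+k}]$.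 For a subgroup $\Gamma$ of $\mathrm{SL}_n(\mathbb{Z})$, $Sh_k\otimes_\Gamma\mathbb{Q}$ denotes the $\Gamma$-coinvariants, $[v_1,\dots,v_{n+k}]_\Gamma$ the image of $[v_1,\dots,v_{n+k}]$ in them, and $\partial$ also denotes the induced boundary map. There is an exact sequence of $\mathrm{GL}_n(\mathbb{Q})$-modules $\cdots\to Sh_1\to Sh_0\to St\to0$, and for $\Gamma$ of finite index in $\mathrm{SL}_n(\mathbb{Z})$, $H_k(\Gamma,St)$ is identified with the $k$-th homology of the complex $Sh_*\otimes_\Gamma\mathbb{Q}$; ''represents a class'' refers to this identification. **Voronoi cones.** $Y$ is the space of real symmetric $n\times n$ matrices (dimension $d$) with a fixed orientation, and $C\subset Y$ the open cone of positive definite matrices, with the compatible orientation. $C^*$ is the union of $C$ with all positive semidefinite symmetric matrices whose kernel is $W\otimes\mathbb{R}$ for some nonzero subspace $W\subset\mathbb{Q}^n$. The group $\mathrm{SL}_n(\mathbb{Z})$ acts on $C^*$ by $\gamma\cdot x=\gamma x\,{}^t\gamma$. For a nonzero column vector $v\in\mathbb{Q}^n$ put $v'=v\,{}^tv\in C^*$. Let $s(v_1,\dots,v_m)$ be the closed convex conical hull of $v_1',\dots,v_m'$; when the $v_i'$ span distinct extremal rays of it they are called its vertices (defined up to positive scalars). A positive definite real quadratic form $Q$ whose minimal nonzero integral vectors are exactly $\pm v_1,\dots,\pm v_m$ is perfect if $v_1',\dots,v_m'$ span $Y$; then $s_Q=s(v_1,\dots,v_m)$ is a $d$-dimensional cone.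 A tile is such a cone $s_Q$ ($Q$ perfect), oriented by the orientation of $Y$. Tiles are permuted by $\mathrm{SL}_n(\mathbb{Z})$, with finitely many orbits. **Triangulations.** A triangulation of a tile $T$ is a decomposition of $T$ into $d$-dimensional simplicial cones whose vertices are among those of $T$, any two of which meet in a common face. Let $H\subset Y$ be an affine hyperplane meeting each ray of $C^*\setminus\{0\}$ in exactly one point (e.g. trace $=1$). The triangulation is regular if its intersection with $H$ is a regular (coherent) triangulation of the polytope $T\cap H$, i.e. there is a continuous convex function on $T\cap H$ that is piecewise affine and whose maximal domains of affineness are exactly the maximal simplices. **Sharbly of a cone; flipons.** For a $d$-dimensional simplicial cone $s$ in $C^*$ with vertices $v_1',\dots,v_d'$ ($v_i\in\mathbb{Q}^n$), $[s]=[v_1,\dots,v_d]\in Sh_t$, where the $v_i$ are listed in an order inducing on $s$ the orientation compatible with that of $Y$. A flipon is a basic $t$-sharbly $[v_1,\dots,v_d]$ such that some affine subspace of $Y$ of dimension $d-2$ contains $v_i'$ for all $i$. **The cycle $z_D$ ($D$ torsionfree).** Choose a set $R_D$ of representatives of the $D$-orbits of tiles and a regular triangulation of each $T\in R_D$; let $\mathcal{S}$ be the set of all resulting $d$-dimensional simplicial cones. Then $z_D=\sum_{s\in\mathcal{S}}[s]_D+\sum_\alpha[y_1^\alpha,\dots,y_d^\alpha]_D$, where $[y_1^\alpha,\dots,y_d^\alpha]$ are finitely many flipons chosen so that $\partial z_D=0$ (such flipons exist). **The map $\iota$.** $\iota:Sh_k\otimes_D\mathbb{Q}\to Sh_k\otimes_G\mathbb{Q}$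 is the natural (well-defined) linear map with $\iota([v_1,\dots,v_{n+k}]_D)=[v_1,\dots,v_{n+k}]_G$; it commutes with $\partial$. *)

(* Defs.v *)
From HB Require Import structures.
From mathcomp Require Import freeg.
From mathcomp Require Import all_boot all_order all_algebra all_fingroup.
From mathcomp Require Import finmap boolp classical_sets cardinality reals.
From mathcomp Require Import topology normedtype convex.
From mathcomp Require Import generic_quotient ring_quotient.
Import Order.TTheory GRing.Theory Num.Theory numFieldNormedType.Exports.

Set Implicit Arguments.
Unset Strict Implicit.
Unset Printing Implicit Defensive.

Local Open Scope ring_scope.
Local Open Scope classical_set_scope.
Local Open Scope quotient_scope.

Section LinearQuotient.
Variables (K : fieldType) (V : lmodType K) (S : set V).

Definition lspan : set V :=
  [set x | exists2 r : seq (K * V),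
     (forall p, p \in r -> S p.2) & x = \sum_(p <- r) p.1 *: p.2].

Definition lspan_pred : {pred V} := fun x => `[< lspan x >].

Lemma lspanP x : reflect (lspan x) (x \in lspan_pred).
Proof. exact: asboolP. Qed.

Lemma sub_lspan x : S x -> lspan x.
Proof.
move=> Sx; exists [:: (1, x)]; last by rewrite big_seq1 scale1r.
by move=> p; rewrite inE => /eqP ->.
Qed.

Lemma lspan0 : lspan 0.
Proof. by exists [::] => //; rewrite big_nil. Qed.

Lemma lspanD x y : lspan x -> lspan y -> lspan (x + y).
Proof.
move=> [r Sr ->] [s Ss ->]; exists (r ++ s); last by rewrite big_cat.
by move=> p; rewrite mem_cat => /orP[/Sr|/Ss].
Qed.

Lemma lspanZ a x : lspan x -> lspan (a *: x).
Proof.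
move=> [r Sr ->]; exists [seq (a * p.1, p.2) | p <- r].
  by move=> p /mapP[q qr ->] /=; exact: Sr.
by rewrite big_map scaler_sumr; apply: eq_bigr => p _; rewrite scalerA.
Qed.

Lemma lspan_sum (I : Type) (r : seq I) (F : I -> V) :
  (forall i, lspan (F i)) -> lspan (\sum_(i <- r) F i).
Proof.
by move=> SF; apply: (big_ind lspan) => //; [exact: lspan0 | exact: lspanD].
Qed.

Lemma lspan_zmod_closed : zmod_closed lspan_pred.
Proof.
split=> [|x y /lspanP Sx /lspanP Sy]; apply/lspanP; first exact: lspan0.
by rewrite -scaleN1r; apply: lspanD => //; exact: lspanZ.
Qed.

HB.instance Definition _ := GRing.isZmodClosed.Build V lspan_pred lspan_zmod_closed.

Definition lquot := Quotient.quot lspan_pred.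

HB.instance Definition _ := GRing.Zmodule.on lquot.
HB.instance Definition _ := Quotient.on lquot.

Definition lproj (x : V) : lquot := \pi_lquot x.
Definition lrepr (x : lquot) : V := repr x.

Lemma lreprK x : lproj (lrepr x) = x.
Proof. exact: reprK. Qed.

Lemma eq_lproj x y : lproj x = lproj y <-> lspan (x - y).
Proof.
split=> [/eqP|/lspanP sxy].
  by rewrite -Quotient.idealrBE => /lspanP.
by apply/eqP; rewrite -Quotient.idealrBE.
Qed.

Lemma lprojD x y : lproj (x + y) = lproj x + lproj y.
Proof. by rewrite /lproj; exact: Quotient.pi_add. Qed.

Definition lquot_scale (a : K) (x : lquot) : lquot := lproj (a *: lrepr x).

Lemma lprojZ a x : lproj (a *: x) = lquot_scale a (lproj x).
Proof.
by apply/eq_lproj; rewrite -scalerBr; apply: lspanZ; apply/eq_lproj; rewrite lreprK.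
Qed.

Lemma lquot_scaleA a b x :
  lquot_scale a (lquot_scale b x) = lquot_scale (a * b) x.
Proof. by rewrite -[x]lreprK -!lprojZ scalerA. Qed.

Lemma lquot_scale1 : left_id 1 lquot_scale.
Proof. by move=> x; rewrite -[x]lreprK -lprojZ scale1r. Qed.

Lemma lquot_scaleDr : right_distributive lquot_scale +%R.
Proof.
move=> a x y; rewrite -[x]lreprK -[y]lreprK -lprojD -!lprojZ scalerDr.
exact: lprojD.
Qed.

Lemma lquot_scaleDl x : {morph lquot_scale^~ x : a b / a + b}.
Proof. by move=> a b; rewrite -[x]lreprK -!lprojZ scalerDl; exact: lprojD. Qed.

HB.instance Definition _ := GRing.Zmodule_isLmodule.Build K lquot
  lquot_scaleA lquot_scale1 lquot_scaleDr lquot_scaleDl.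

Lemma lproj_is_linear : linear lproj.
Proof. by move=> a x y; rewrite lprojD lprojZ. Qed.

HB.instance Definition _ :=
  GRing.isLinear.Build K V lquot _ lproj lproj_is_linear.

End LinearQuotient.

(** The map induced by [f] between quotients.  It is defined on representatives
    without a compatibility proof; [lquot_mapE] characterizes it when [f] is
    linear and compatible with the two sets of relations. *)
Section LinearQuotientMap.
Variables (K : fieldType) (V W : lmodType K) (S : set V) (S' : set W).

Definition lquot_map (f : V -> W) (x : lquot S) : lquot S' :=
  lproj S' (f (lrepr x)).

Variable f : V -> W.
Hypothesis linf : linear f.
Hypothesis fS : forall x, S x -> lspan S' (f x).

Let F : {linear V -> W} := HB.pack f (GRing.isLinear.Build K V W _ f linf).

Lemma lspan_map x : lspan S x -> lspan S' (f x).
Proof.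
move=> [r Sr ->]; rewrite -[f]/(F : V -> W) linear_sum big_seq.
apply: (big_ind (lspan S')); [exact: lspan0 | exact: lspanD |].
by move=> p /Sr Sp; rewrite linearZ; apply: lspanZ; exact: fS.
Qed.

Lemma lquot_mapE x : lquot_map f (lproj S x) = lproj S' (f x).
Proof.
apply/eq_lproj; rewrite -[f]/(F : V -> W) -linearB; apply: lspan_map.
by apply/eq_lproj; rewrite lreprK.
Qed.

Lemma lquot_map_linear : linear (lquot_map f).
Proof.
move=> a x y; rewrite -[x]lreprK -[y]lreprK -linearP !lquot_mapE.
by rewrite linf linearP.
Qed.

End LinearQuotientMap.

Arguments lquot_map {K V W S S'} f x.

Section Symbols.
Variable n : nat.

(** A symbol [v_1, ..., v_(n+k)] is the matrix with the nonzero columns [v_i].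
    The number of columns is written [k + n] so that it computes on
    successors of [k]. *)
Definition symbol (k : nat) :=
  {A : 'M[rat]_(n, k + n) | [forall j, col j A != 0]}.

Lemma del_symbol_subproof k (j : 'I_(k.+1 + n)) (A : symbol k.+1) :
  [forall l, col l (col' j (val A) : 'M_(n, k + n)) != 0].
Proof.
apply/forallP => l; have /forallP/(_ (lift j l : 'I_(k.+1 + n))) := valP A.
by apply: contra_neq => /colP E; apply/colP => i; have := E i; rewrite !mxE.
Qed.

Definition del_symbol k (j : 'I_(k.+1 + n)) (A : symbol k.+1) : symbol k :=
  exist _ (col' j (val A) : 'M_(n, k + n)) (del_symbol_subproof j A).

Definition GLQ := {g : 'M[rat]_n | g \in unitmx}.

Lemma act_symbol_subproof k (g : GLQ) (A : symbol k) :
  [forall l, col l (val g *m val A) != 0].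
Proof.
apply/forallP => l; rewrite colE -mulmxA -colE.
have /forallP/(_ l) := valP A; apply: contra_neq => E.
by rewrite -[col l _](mulKmx (valP g)) E mulmx0.
Qed.

Definition act_symbol k (g : GLQ) (A : symbol k) : symbol k :=
  exist _ (val g *m val A) (act_symbol_subproof g A).

Definition chain k := {freeg (symbol k) / rat}.

Variant sharbly_rel k : chain k -> Prop :=
| SharblyPerm (A B : symbol k) (s : 'S_(k + n)) of
    val B = col_perm s (val A) :
    sharbly_rel (<< B >> - (-1) ^+ s *: << A >>)
| SharblySpan (A : symbol k) of (\rank (val A) < n)%N : sharbly_rel << A >>
| SharblyScale (A B : symbol k) (a : rat) of a != 0 &
    (forall i j, val B i j = (if j == 0%N :> nat then a else 1) * val A i j) :
    sharbly_rel (<< A >> - << B >>).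

Definition Sh k := lquot (@sharbly_rel k).

Definition sharbly k (A : symbol k) : Sh k := lproj _ << A >>.

Definition chain_boundary k : chain k.+1 -> chain k :=
  fglift (fun A => \sum_(j < k.+1 + n) (-1) ^+ j *: << del_symbol j A >>).

(** The convention is [Sh_(-1) = 0]: the boundary out of degree 0 is the zero
    map (into the degree [0.-1 = 0]). *)
Definition Sh_boundary k : Sh k -> Sh k.-1 :=
  match k with
  | 0 => fun _ => 0
  | k'.+1 => lquot_map (@chain_boundary k')
  end.

Definition chain_act k (g : GLQ) : chain k -> chain k :=
  fglift (fun A => << act_symbol g A >>).

Definition Sh_act k (g : GLQ) : Sh k -> Sh k := lquot_map (@chain_act k g).

(** [Sh_k (x)_Gamma Q], the coinvariants for a set [Gamma] of integral
    matrices (a subgroup of SL_n(Z) in all uses). *)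
Definition coinvariant_rel (Gamma : set 'M[int]_n) k : set (Sh k) :=
  [set x | exists (h : 'M[int]_n) (g : GLQ) (y : Sh k),
     [/\ Gamma h, val g = map_mx intr h & x = Sh_act g y - y]].

Definition coinvariants (Gamma : set 'M[int]_n) k :=
  lquot (@coinvariant_rel Gamma k).

Definition sharbly_class Gamma k (A : symbol k) : coinvariants Gamma k :=
  lproj _ (sharbly A).

Definition coinv_boundary Gamma k :
    coinvariants Gamma k -> coinvariants Gamma k.-1 :=
  lquot_map (@Sh_boundary k).

Definition coinv_iota (D G : set 'M[int]_n) k :
  coinvariants D k -> coinvariants G k := lquot_map id.

(** [z] is a cycle of the complex of coinvariants and its class in the k-th
    homology [ker / im] is nonzero. *)
Definition nonzero_homology_class Gamma k (z : coinvariants Gamma k) : Prop :=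
  coinv_boundary z = 0 /\
  ~ exists w : coinvariants Gamma k.+1, coinv_boundary w = z.

End Symbols.

Section WellDefined.
Variable n : nat.

Lemma fglift_linear (K : choiceType) (M : lmodType rat) (f : K -> M) :
  linear (fglift f : {freeg K / rat} -> M).
Proof.
have addf := lift_is_additive f.
pose F : {additive {freeg K / rat} -> M} :=
  HB.pack (fglift f : {freeg K / rat} -> M)
    (GRing.isZmodMorphism.Build {freeg K / rat} M _ addf).
have FU c x : F << c *g x >> = c *: f x by rewrite /F /= liftU.
have FE D : F D = \sum_(x <- freeg.dom D) freeg.coeff x D *: f x.
  rewrite -{1}(freeg_sumE D) raddf_sum.
  by apply: eq_bigr => x _; rewrite FU.
have FZ c D : F (c *: D) = c *: F D.
  have -> : c *: D = \sum_(x <- freeg.dom D) << c * freeg.coeff x D *g x >> by [].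
  rewrite raddf_sum FE scaler_sumr; apply: eq_bigr => x _.
  by rewrite FU scalerA.
move=> a x y; rewrite -[fglift f]/(F : _ -> _).
by rewrite raddfD FZ.
Qed.

Lemma chain_boundary_linear k : linear (@chain_boundary n k).
Proof. exact: fglift_linear. Qed.

Lemma chain_act_linear k g : linear (@chain_act n k g).
Proof. exact: fglift_linear. Qed.

Lemma chain_boundaryU k (A : symbol n k.+1) :
  chain_boundary << A >> =
  \sum_(j < k.+1 + n) (-1) ^+ j *: << del_symbol j A >>.
Proof. by rewrite /chain_boundary liftU scale1r. Qed.

Lemma chain_actU k g (A : symbol n k) : chain_act g << A >> = << act_symbol g A >>.
Proof. by rewrite /chain_act liftU scale1r. Qed.


Lemma chain_act_rel k g (x : chain n k) :
  sharbly_rel x -> lspan (@sharbly_rel n k) (chain_act g x).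
Proof.
pose F : {linear chain n k -> chain n k} :=
  HB.pack (chain_act g) (GRing.isLinear.Build _ _ _ _ _ (@chain_act_linear k g)).
rewrite -[chain_act g]/(F : _ -> _).
case=> [A B s AB|A rA|A B a a0 AB]; apply: sub_lspan.
- rewrite linearB linearZ /F /= !chain_actU; apply: SharblyPerm.
  by rewrite /= AB col_permE mulmxA -col_permE.
- rewrite /F /= chain_actU; apply: SharblySpan => /=.
  by apply: leq_ltn_trans (mxrankM_maxr _ _) rA.
- rewrite linearB /F /= !chain_actU; apply: (SharblyScale a0) => i j /=.
  rewrite !mxE mulr_sumr; apply: eq_bigr => l _.
  by rewrite AB mulrCA.
Qed.

Lemma perm_lift N (s : 'S_N.+1) (j : 'I_N.+1) :
  exists u : 'S_N, s = lift_perm j (s j) u.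
Proof.
pose f l := odflt l (unlift (s j) (s (lift j l))).
have fE l : lift (s j) (f l) = s (lift j l).
  rewrite /f; case: unliftP => [m ->//|/perm_inj /esym/eqP].
  by rewrite (negPf (neq_lift _ _)).
have inj_f : injective f.
  by move=> l m /(congr1 (lift (s j))); rewrite !fE => /perm_inj/lift_inj.
exists (perm inj_f); apply/permP => l; have [->|jl] := eqVneq l j.
  by rewrite lift_perm_id.
move: jl; rewrite eq_sym => /unlift_some[m -> _].
by rewrite lift_perm_lift permE fE.
Qed.

Lemma chain_boundary_rel k (x : chain n k.+1) :
  sharbly_rel x -> lspan (@sharbly_rel n k) (chain_boundary x).
Proof.
pose F : {linear chain n k.+1 -> chain n k} :=
  HB.pack (@chain_boundary n k)
    (GRing.isLinear.Build _ _ _ _ _ (@chain_boundary_linear k)).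
rewrite -[@chain_boundary n k]/(F : _ -> _).
case=> [A B s AB|A rA|A B a a0 AB].
- rewrite linearB linearZ /F /= !chain_boundaryU.
  rewrite [X in _ - _ *: X](reindex_inj (@perm_inj _ s)) /= scaler_sumr -sumrB.
  apply: lspan_sum => j; have [u su] := @perm_lift (k + n) s j.
  rewrite scalerA (_ : _ * _ = (-1) ^+ j * (-1) ^+ u).
    rewrite -scalerA -scalerBr; apply: lspanZ; apply: sub_lspan.
    apply: SharblyPerm; apply/matrixP => i l; rewrite /= AB !mxE.
    by rewrite {1}su; congr (val A i _); rewrite -(lift_perm_lift j (s j) u).
  rewrite {1}su odd_lift_perm 2!signr_addb !signr_odd.
  by rewrite -!mulrA (mulrCA _ ((-1) ^+ u)) -expr2 sqrr_sign mulr1.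
- rewrite /F /= chain_boundaryU; apply: lspan_sum => j; apply: lspanZ.
  apply: sub_lspan; apply: SharblySpan => /=; apply: leq_ltn_trans rA.
  rewrite col'Esub (_ : colsub _ _ = val A *m colsub (lift j) 1%:M).
    exact: mxrankM_maxl.
  by rewrite mulmx_colsub mulmx1.
- rewrite linearB /F /= !chain_boundaryU -sumrB; apply: lspan_sum => j.
  rewrite -scalerBr; apply: lspanZ; case: (posnP j) => j0.
    rewrite (_ : del_symbol j A = del_symbol j B) ?subrr; first exact: lspan0.
    apply: val_inj; apply/matrixP => i l; rewrite /= !mxE AB.
    by rewrite /= /bump j0 mul1r.
  apply: sub_lspan; apply: (SharblyScale a0) => i l; rewrite /= !mxE AB.
  by rewrite /= /bump; case: (l : nat) => [|l']; rewrite ?addn_eq0 ?andbF // leqNgt j0.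
Qed.

Lemma Sh_boundaryE k (A : symbol n k.+1) :
  Sh_boundary (sharbly A) =
  \sum_(j < k.+1 + n) (-1) ^+ j *: sharbly (del_symbol j A).
Proof.
rewrite /= lquot_mapE ?chain_boundaryU; last exact: chain_boundary_rel.
  by rewrite linear_sum; apply: eq_bigr => j _; exact: lprojZ.
exact: chain_boundary_linear.
Qed.

Lemma Sh_actE k g (A : symbol n k) : Sh_act g (sharbly A) = sharbly (act_symbol g A).
Proof.
rewrite /Sh_act lquot_mapE ?chain_actU //; last exact: chain_act_rel.
exact: chain_act_linear.
Qed.

Lemma Sh_boundary_linear k : linear (@Sh_boundary n k).
Proof.
case: k => [|k]; first by move=> a x y /=; rewrite scaler0 addr0.
by apply: lquot_map_linear; [exact: chain_boundary_linear | exact: chain_boundary_rel].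
Qed.

Lemma Sh_act_linear k g : linear (@Sh_act n k g).
Proof.
by apply: lquot_map_linear; [exact: chain_act_linear | exact: chain_act_rel].
Qed.

Lemma chain_ext (K : choiceType) (M : lmodType rat) (f f' : {freeg K / rat} -> M) :
  linear f -> linear f' -> (forall x, f << x >> = f' << x >>) -> f =1 f'.
Proof.
move=> lf lf' ff' c.
pose F : {linear {freeg K / rat} -> M} := HB.pack f (GRing.isLinear.Build _ _ _ _ f lf).
pose F' : {linear {freeg K / rat} -> M} := HB.pack f' (GRing.isLinear.Build _ _ _ _ f' lf').
rewrite -[f]/(F : _ -> _) -[f']/(F' : _ -> _) -(freeg_sumE c) !linear_sum.
apply: eq_bigr => x _.
have -> : << freeg.coeff x c *g x >> = freeg.coeff x c *: << x >> :> {freeg K / rat}.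
  by apply/eqP/freeg_eqP => y; rewrite coeffZ !coeffU mul1r.
by rewrite !linearZ /= ff'.
Qed.

Lemma chain_boundary_act k g (c : chain n k.+1) :
  chain_boundary (chain_act g c) = chain_act g (chain_boundary c).
Proof.
pose f1 (c : chain n k.+1) := chain_boundary (chain_act g c).
pose f2 (c : chain n k.+1) := chain_act g (chain_boundary c).
apply: (@chain_ext _ _ f1 f2); rewrite /f1 /f2.
- by move=> a u v; rewrite chain_act_linear chain_boundary_linear.
- by move=> a u v; rewrite chain_boundary_linear chain_act_linear.
move=> A; rewrite chain_actU !chain_boundaryU.
pose F : {linear chain n k -> chain n k} :=
  HB.pack (chain_act g) (GRing.isLinear.Build _ _ _ _ _ (@chain_act_linear k g)).
rewrite -[chain_act g]/(F : _ -> _) linear_sum; apply: eq_bigr => j _.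
rewrite linearZ /F /= chain_actU; congr (_ *: << _ >>); apply: val_inj.
by apply/matrixP => i l; rewrite /= !mxE; apply: eq_bigr => m _; rewrite !mxE.
Qed.

Lemma Sh_boundary_act k g (x : Sh n k) :
  Sh_boundary (Sh_act g x) = Sh_act g (Sh_boundary x).
Proof.
case: k x => [|k] x /=.
  pose F : {linear Sh n 0 -> Sh n 0} :=
    HB.pack (Sh_act g) (GRing.isLinear.Build _ _ _ _ _ (@Sh_act_linear 0 g)).
  by rewrite -[Sh_act g]/(F : _ -> _) linear0.
have Eb c := lquot_mapE (@chain_boundary_linear k) (@chain_boundary_rel k) c.
have Ea m c := lquot_mapE (@chain_act_linear m g) (@chain_act_rel m g) c.
by rewrite -[x]lreprK /Sh_act Ea !Eb Ea chain_boundary_act.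
Qed.

Lemma coinv_boundaryE Gamma k (x : Sh n k) :
  coinv_boundary (lproj (@coinvariant_rel n Gamma k) x) = lproj _ (Sh_boundary x).
Proof.
rewrite /coinv_boundary lquot_mapE //; first exact: Sh_boundary_linear.
move=> _ [h [g [y [Gh gh ->]]]].
pose F : {linear Sh n k -> Sh n k.-1} :=
  HB.pack (@Sh_boundary n k) (GRing.isLinear.Build _ _ _ _ _ (@Sh_boundary_linear k)).
rewrite -[@Sh_boundary n k]/(F : _ -> _) linearB /F /= Sh_boundary_act.
by apply: sub_lspan; exists h, g, (Sh_boundary y).
Qed.

Lemma coinv_iotaE (D G : set 'M[int]_n) k (x : Sh n k) : D `<=` G ->
  coinv_iota G (lproj (@coinvariant_rel n D k) x) = lproj _ x.
Proof.
move=> DG; rewrite /coinv_iota lquot_mapE // => _ [h [g [y [Dh gh ->]]]].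
by apply: sub_lspan; exists h, g, y; split=> //; exact: DG.
Qed.

End WellDefined.

Section Groups.
Variable n : nat.
Implicit Types G H : set 'M[int]_n.

Definition SLZ : set 'M[int]_n := [set g | \det g = 1].

Definition subgroup H G : Prop :=
  [/\ H `<=` G, H 1%:M, (forall g h, H g -> H h -> H (g *m h))
    & (forall g, H g -> H (invmx g))].

Definition normal_in H G : Prop :=
  forall g h, G g -> H h -> H (g *m h *m invmx g).

Definition torsionfree G : Prop :=
  forall g m, G g -> (0 < m)%N -> g ^+ m = 1%:M -> g = 1%:M.

Definition left_cosets H G : set (set 'M[int]_n) :=
  [set [set g *m h | h in H] | g in G].

Definition finite_index H G : Prop := finite_set (left_cosets H G).

Definition group_index H G : nat := #|` fset_set (left_cosets H G)|.

End Groups.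

Arguments SLZ : clear implicits.

Section Voronoi.
Variables (R : realType) (n : nat).
Implicit Types (T s : set 'M[R]_n) (K : set (set 'M[R]_n)).

Definition symY : {vspace 'M[R]_n} := fixedSpace (linfun (@trmx R n n)).

Lemma mem_symY y : (y \in symY) = (y^T == y).
Proof. by apply/fixedSpaceP/eqP; rewrite lfunE. Qed.

Definition qform (y : 'M[R]_n) (x : 'cV[R]_n) : R := (x^T *m y *m x) 0 0.

Definition posdef (y : 'M[R]_n) : Prop :=
  y \in symY /\ forall x, x != 0 -> 0 < qform y x.

Definition possemidef (y : 'M[R]_n) : Prop :=
  y \in symY /\ forall x, 0 <= qform y x.

Definition Cstar : set 'M[R]_n :=
  [set y | posdef y \/ (possemidef y /\
     exists W : 'M[rat]_n, W != 0 /\ (kermx y == map_mx ratr W)%MS)].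

Definition rank_one (v : 'cV[rat]_n) : 'M[R]_n := map_mx ratr (v *m v^T).

(** [s(v_1, ..., v_m)] for the columns [v_j] of [A]; a finitely generated
    convex cone is closed. *)
Definition cone m (A : 'M[rat]_(n, m)) : set 'M[R]_n :=
  [set y | exists2 c : 'I_m -> R, (forall j, 0 <= c j)
         & y = \sum_j c j *: rank_one (col j A)].

Definition extremal_ray T (y : 'M[R]_n) : Prop :=
  [/\ T y, y != 0 & forall a b, T a -> T b -> a + b = y ->
     exists2 c : R, 0 <= c & a = c *: y].

Definition minimal_vector (q : 'M[R]_n) (v : 'cV[int]_n) : Prop :=
  v != 0 /\ forall w : 'cV[int]_n, w != 0 ->
    qform q (map_mx intr v) <= qform q (map_mx intr w).

Definition tile T : Prop :=
  exists (q : 'M[R]_n) (m : nat) (V : 'M[int]_(n, m)),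
    [/\ posdef q,
       (forall v, minimal_vector q v <->
          exists j, v = col j V \/ v = - col j V),
       <<[seq rank_one (col j (map_mx intr V)) | j <- enum 'I_m]>>%VS = symY
     & T = cone (map_mx intr V)].

Definition act_cone (g : 'M[int]_n) T : set 'M[R]_n :=
  [set map_mx intr g *m y *m (map_mx intr g)^T | y in T].

Definition orbit_representatives (D : set 'M[int]_n) (RD : set (set 'M[R]_n)) :=
  RD `<=` tile /\
  forall T, tile T -> exists! T', RD T' /\ exists2 g, D g & T = act_cone g T'.

Definition face s F : Prop :=
  [/\ F `<=` s, F 0,
     (forall (a b : R) x y, 0 <= a -> 0 <= b -> F x -> F y -> F (a *: x + b *: y))
   & (forall x y, s x -> s y -> F (x + y) -> F x /\ F y)].

(** The degree [t = n(n-1)/2], so that [tdeg + n = n(n+1)/2] is the dimension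
    of [symY]. *)
Definition tdeg : nat := (n * n.-1)./2.

Definition triangulation T K : Prop :=
  [/\ (forall s, K s -> exists A : symbol n tdeg,
         [/\ s = cone (val A),
            free [seq rank_one (col j (val A)) | j <- enum 'I_(tdeg + n)]
          & forall j, extremal_ray T (rank_one (col j (val A)))]),
     T = \bigcup_(s in K) s
   & (forall s1 s2, K s1 -> K s2 ->
        face s1 (s1 `&` s2) /\ face s2 (s1 `&` s2))].

Definition section_hyperplane (H : set 'M[R]_n) : Prop :=
  (exists (l : {scalar 'M[R]_n}) (c : R),
     (exists2 y, y \in symY & l y != 0) /\
     H = [set y | y \in symY /\ l y = c]) /\
  forall y, Cstar y -> y != 0 -> exists! a : R, 0 < a /\ H (a *: y).

Definition affine_on (A : set 'M[R]_n) (f : 'M[R]_n -> R) : Prop :=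
  exists (l : {scalar 'M[R]_n}) (c : R), forall y, A y -> f y = l y + c.

Definition piecewise_affine (P : set 'M[R]_n) (f : 'M[R]_n -> R) : Prop :=
  exists As : seq (set 'M[R]_n),
    (forall A, A \in As -> convex_set A /\ affine_on A f) /\
    P = [set y | exists2 A, A \in As & A y].

Definition affineness_domain (P : set 'M[R]_n) (f : 'M[R]_n -> R) :
    set (set 'M[R]_n) :=
  [set A | [/\ A `<=` P, convex_set A & affine_on A f]].

Definition maximal_affineness_domain P f (A : set 'M[R]_n) : Prop :=
  affineness_domain P f A /\
  forall B, affineness_domain P f B -> A `<=` B -> B = A.

Definition regular (H : set 'M[R]_n) T K : Prop :=
  exists f : 'M[R]_n -> R,
    [/\ {within T `&` H, continuous f},
       convex_function (T `&` H) (f : _ -> R^o),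
       piecewise_affine (T `&` H) f
     & forall A, maximal_affineness_domain (T `&` H) f A <->
                 exists2 s, K s & A = s `&` H].

(** The fixed orientation of [symY] is given by an ordered basis [E].  The
    matrix of coordinates is invertible only if the cone is [d]-dimensional. *)
Definition positively_oriented (E : (tdeg + n).-tuple 'M[R]_n)
    (A : symbol n tdeg) : Prop :=
  0 < \det (\matrix_(i, j) coord E j (rank_one (col i (val A)))).

Definition flipon (A : symbol n tdeg) : Prop :=
  exists (p : 'M[R]_n) (V : {vspace 'M[R]_n}),
    [/\ p \in symY, (V <= symY)%VS, \dim V = (tdeg + n - 2)%N
      & forall j, rank_one (col j (val A)) - p \in V].

(** The list [As] contains, for each cone [s] of the triangulations of the
    representatives, exactly one symbol [A] with [s = cone A] whose columns
    are positively ordered, so that [sharbly A] is the sharbly [s]. *)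
Definition voronoi_cycle (E : (tdeg + n).-tuple 'M[R]_n) (H : set 'M[R]_n)
    (D : set 'M[int]_n) (z : coinvariants D tdeg) : Prop :=
  exists (RD : set (set 'M[R]_n)) (tri : set 'M[R]_n -> set (set 'M[R]_n))
         (As Fs : seq (symbol n tdeg)),
    [/\ orbit_representatives D RD,
       (forall T, RD T -> triangulation T (tri T) /\ regular H T (tri T)),
       [/\ uniq As, {in As &, injective (fun A => cone (val A))},
          (forall A, A \in As -> positively_oriented E A)
        & \bigcup_(T in RD) tri T = [set cone (val A) | A in [set` As]]],
       (forall A, A \in Fs -> flipon A)
     & z = \sum_(A <- As) sharbly_class D A + \sum_(A <- Fs) sharbly_class D A
       /\ coinv_boundary z = 0].

End Voronoi.

(* Main.v *)
From HB Require Import structures.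
Require Import Defs.
From mathcomp Require Import freeg.
From mathcomp Require Import all_boot all_order all_algebra all_fingroup.
From mathcomp Require Import finmap boolp classical_sets cardinality.
From mathcomp Require Import fsbigop reals ereal lebesgue_measure.
From mathcomp Require Import zify ring lra.
Import Order.TTheory GRing.Theory Num.Theory.

(** The class is detected by a linear form on the [t]-sharblies, a degree.

    Fix a point [xi] of the space [Y] of symmetric matrices, of dimension [d].  A
    symbol [A] with columns [v_1, ..., v_d] has a local index at [xi]: the
    orientation sign of the vectors [v_i' = v_i v_i^T] if [xi] lies in the open
    simplicial cone that they span, and [0] otherwise ([cone_index]).  The degree of
    [A] is the sum of the indices of the translates [g A] for [g] in [G].

    - The sum has finitely many nonzero terms when [xi] is positive definite
      and is a positive combination of rational rank one forms that span.  This
      is a reduction theory argument ([finite_cone_orbit]), based on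
      the positive minimum of [xi] on the nonzero lattice vectors.
    - The degree respects the relations between symbols and is invariant under
      [G] by construction, hence descends to the coinvariants.
    - It kills boundaries.  Given [d + 1] vectors in an open half space of [Y],
      the simplicial cones obtained by omitting one of them have signed indices
      with sum zero at a point in general position: the nonnegative ways of
      writing [xi] as a combination of the [d + 1] vectors form a segment, and
      the cones that contain [xi] correspond to its two ends
      ([cone_index_boundary]).  General position means avoiding countably many
      hyperplanes, one for each choice of rational vectors
      ([exists_general_position]).

    The degree of the cycle is positive when [xi] is chosen inside one of the
    cones of the triangulated tiles.  The flipons contribute nothing, as their rank
    one forms are linearly dependent.  All the cones of the triangulations are
    positively oriented and remain so under [G], because matrices of positive
    determinant preserve the orientation of [Y] ([det_sym_action_gt0]); so their
    degrees are nonnegative, and the chosen cone has positive degree thanks to the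
    term [g = 1].  There is such a cone because there is a perfect form
    ([tile_exists]). *)

Set Implicit Arguments.
Unset Strict Implicit.
Unset Printing Implicit Defensive.
Local Open Scope ring_scope.

(** * Matrices of positive determinant are products of squares *)

Definition mx_character (R : rcfType) n (chi : 'M[R]_n -> R) : Prop :=
  (forall g h, chi (g *m h) = chi g * chi h) /\ chi 1%:M = 1.

(** The matrices on which every multiplicative character takes a positive value.
    A square [b *m b] of an invertible [b] is such a matrix, and so is any
    product of squares; quantifying over the characters avoids having to carry
    explicit factorizations. *)
Definition positive_mx (R : rcfType) n (g : 'M[R]_n) : Prop :=
  forall chi, mx_character chi -> 0 < chi g.

Section Positive.
Variable R : rcfType.

Lemma mx_character_det n : mx_character (@determinant R n).
Proof. by split=> [g h|]; rewrite ?det_mulmx ?det1. Qed.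

Lemma positive_mx_cancel n (a g : 'M[R]_n) :
  positive_mx a -> positive_mx (a *m g) -> positive_mx g.
Proof.
move=> Pa Pag chi chiP; have := Pag _ chiP.
by rewrite chiP.1 pmulr_rgt0 // Pa.
Qed.

Lemma positive_mxM n (a b : 'M[R]_n) :
  positive_mx a -> positive_mx b -> positive_mx (a *m b).
Proof. by move=> Pa Pb chi cP; rewrite cP.1 mulr_gt0 ?(Pa _ cP) ?(Pb _ cP). Qed.

Lemma rank1_updateM n (u : 'cV[R]_n) (v : 'rV[R]_n) (a b : R) :
  (1%:M + a *: (u *m v)) *m (1%:M + b *: (u *m v)) =
  1%:M + (a + b + a * b * (v *m u) 0 0) *: (u *m v).
Proof.
have /esym E := mx11_scalar (v *m u).
have uvuv : u *m v *m (u *m v) = (v *m u) 0 0 *: (u *m v).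
  by rewrite -mulmxA (mulmxA v) -E mul_scalar_mx -scalemxAr [_%:M _ _]mxE mulr1n.
rewrite mulmxDl mul1mx mulmxDr mulmx1 -scalemxAl -scalemxAr uvuv.
by rewrite !scalerA !scalerDl -!addrA; congr (_ + _); exact: addrCA.
Qed.

(** A rank one update [1 + u v] of positive determinant is a square: its square
    root is again of the form [1 + a u v]. *)
Lemma positive_rank1_update n (u : 'cV[R]_n) (v : 'rV[R]_n) :
  -1 < (v *m u) 0 0 -> positive_mx (1%:M + u *m v).
Proof.
set c : R := (v *m u) 0 0 => c1 chi chiP.
have c0 : 0 < 1 + c by lra.
pose s := Num.sqrt (1 + c).
have s0 : 0 < s by rewrite sqrtr_gt0.
have s2 : s ^+ 2 = 1 + c by rewrite sqr_sqrtr // ltW.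
(* [(1 + a u v) ^ 2 = 1 + (2 a + a^2 c) u v], and this [a] solves
   [2 a + a^2 c = 1]. *)
pose a := (1 + s)^-1.
have sq : (1%:M + a *: (u *m v)) *m (1%:M + a *: (u *m v)) = 1%:M + u *m v.
  rewrite rank1_updateM -/c -[u *m v in RHS]scale1r; congr (_ + _ *: _).
  have -> : c = s ^+ 2 - 1 by rewrite s2; ring.
  by rewrite /a; field; lra.
have inv : (1%:M + u *m v) *m (1%:M - (1 + c)^-1 *: (u *m v)) = 1%:M.
  rewrite -[u *m v in X in X *m _]scale1r -scaleNr rank1_updateM -/c.
  rewrite (_ : 1 - _ + _ = 0) ?scale0r ?addr0 //; field; lra.
have chi0 : chi (1%:M + u *m v) != 0.
  apply/eqP => E; have := chiP.2; rewrite -inv chiP.1 E mul0r => /esym/eqP.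
  by rewrite oner_eq0.
rewrite lt_def chi0 -sq chiP.1 -expr2; exact: sqr_ge0.
Qed.

(** The first step of a Gaussian elimination by rank one updates.  Mapping
    [w = g e_0] to [e_0] takes [1 + (e_0 - w) v] with [v w = 1], whose
    determinant is [v_0]; a [v] with [v_0 > 0] exists unless [w] is a negative
    multiple of [e_0], and in that case a transvection is applied first. *)
Lemma positive_mx_col0 n (g : 'M[R]_n.+2) : g \in unitmx ->
  exists2 a : 'M[R]_n.+2, positive_mx a &
    a *m g *m delta_mx 0 0 = delta_mx 0 0 :> 'cV_n.+2.
Proof.
move=> gU.
pose e i : 'cV[R]_n.+2 := delta_mx i 0.
pose f i : 'rV[R]_n.+2 := delta_mx 0 i.
have feE i j : (f i *m e j) 0 0 = (i == j)%:R.
  by rewrite /f -rowE !mxE eqxx andbT.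
have fwE i (w : 'cV[R]_n.+2) : (f i *m w) 0 0 = w i 0 by rewrite /f -rowE mxE.
have key w (v : 'rV[R]_n.+2) : (v *m w) 0 0 = 1 -> 0 < v 0 0 ->
    exists2 a : 'M[R]_n.+2, positive_mx a & a *m w = e 0.
  move=> vw v0; exists (1%:M + (e 0 - w) *m v); last first.
    rewrite mulmxDl mul1mx -mulmxA [v *m w]mx11_scalar vw mulmx1.
    by rewrite addrCA subrr addr0.
  apply: positive_rank1_update; rewrite mulmxBr mxE [X in _ + X]mxE vw.
  by rewrite /e -colE mxE; lra.
have key2 (w : 'cV[R]_n.+2) i : i != 0 -> w i 0 != 0 ->
    exists2 a : 'M[R]_n.+2, positive_mx a & a *m w = e 0.
  move=> i0 wi; apply: (key w (f 0 + ((1 - w 0 0) / w i 0) *: f i)).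
    by rewrite mulmxDl -scalemxAl mxE [X in _ + X]mxE !fwE; field.
  by rewrite !mxE !eqxx [0 == i]eq_sym (negPf i0) mulr0 addr0 ltr01.
pose w := g *m e 0.
have w0 : w != 0.
  apply: contraTneq isT => w0; have := congr1 (fun x => f 0 *m (invmx g *m x)) w0.
  rewrite /w mulKmx // !mulmx0 => /matrixP/(_ 0 0); rewrite feE eqxx !mxE.
  by move/eqP; rewrite oner_eq0.
suff [a Pa aw] : exists2 a : 'M[R]_n.+2, positive_mx a & a *m w = e 0.
  by exists a => //; rewrite -mulmxA.
move: w w0 => {g gU} w w0.
have [/existsP[i /andP[i0 wi]]|/existsPn nw] :=
    boolP [exists i, (i != 0) && (w i 0 != 0)]; first exact: (@key2 w i).
have wE : w = w 0 0 *: e 0.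
  apply/colP => i; rewrite !mxE; have [->|i0] := eqVneq i 0.
    by rewrite eqxx mulr1.
  by have := nw i; rewrite i0 /= mulr0 negbK => /eqP.
have w00 : w 0 0 != 0.
  by apply: contra_neq w0 => E; rewrite wE E scale0r.
pose i1 : 'I_n.+2 := lift 0 0.
pose b := 1%:M + e i1 *m ((w 0 0)^-1 *: f 0).
have Pb : positive_mx b.
  by apply: positive_rank1_update; rewrite -scalemxAl mxE feE mulr0; lra.
have bw : b *m w = w + e i1.
  rewrite mulmxDl mul1mx -mulmxA; congr (_ + _).
  by rewrite [_ *m w]mx11_scalar -scalemxAl mxE fwE mulVf // mulmx1.
have [||a Pa aw] := @key2 (b *m w) i1; [by [] | |].
  by rewrite bw wE !mxE !eqxx /= mulr0 add0r oner_eq0.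
by exists (a *m b); [exact: positive_mxM | rewrite -mulmxA].
Qed.

(** The group of real matrices of positive determinant is generated by squares,
    by elimination and induction on the size.  It plays the role of the
    connectedness of this group, and is applied below to the determinant of its
    action on the symmetric matrices. *)
Lemma det_gt0_positive_mx n (g : 'M[R]_n) : 0 < \det g -> positive_mx g.
Proof.
elim: n g => [|[|n] IH] g g0.
- by move=> chi [_ chi1]; rewrite (flatmx0 g) -(flatmx0 1%:M) chi1.
- rewrite (_ : g = 1%:M + (g - 1%:M) *m (1%:M : 'M_1)); last first.
    by rewrite mulmx1 addrCA subrr addr0.
  apply: positive_rank1_update; rewrite mul1mx !mxE eqxx mulr1n.
  by move: g0; rewrite det_mx11; lra.
have [|a Pa] := @positive_mx_col0 n g; first by rewrite unitmxE unitfE gt_eqF.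
rewrite -colE => ag0; apply: (positive_mx_cancel Pa).
have: 0 < \det (a *m g).
  by rewrite det_mulmx mulr_gt0 // (Pa _ (@mx_character_det n.+2)).
move: (a *m g : 'M[R]_(1 + n.+1)) ag0 => {a Pa g g0} g ge0 g0.
pose r := ursubmx g; pose h := drsubmx g.
have gE : g = block_mx 1%:M r 0 h.
  rewrite -[LHS]submxK; congr block_mx; apply/matrixP => i j.
    have /colP/(_ (lshift _ i)) := ge0; rewrite !mxE !ord1 /= => <-.
    by congr (g _ _); exact: val_inj.
  have /colP/(_ (@rshift 1 n.+1 i)) := ge0; rewrite !mxE !ord1 /= => E.
  by rewrite -[RHS]E; congr (g _ _); exact: val_inj.
have -> : g = block_mx 1%:M 0 0 h *m block_mx 1%:M r 0 1%:M.
  by rewrite mulmx_block !mulmx0 !mul0mx !mulmx1 !mul1mx !addr0 ?add0r gE.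
apply: positive_mxM.
  have h0 : 0 < \det h by have := @det_ublock _ 1 n.+1 1%:M r h; rewrite -gE det1 mul1r => <-.
  move=> chi [chiM chi1].
  pose chi' (h : 'M[R]_n.+1) := chi (block_mx 1%:M 0 0 h : 'M_(1 + n.+1)).
  have chi'P : mx_character chi'.
    split=> [g1 g2|]; last by rewrite /chi' -scalar_mx_block.
    rewrite -chiM; congr chi.
    have := @mulmx_block _ 1 n.+1 1 n.+1 1 n.+1 1%:M 0 0 g1 1%:M 0 0 g2.
    by rewrite !mulmx0 !mul0mx !mulmx1 !addr0 !add0r => /esym.
  exact: IH h0 _ chi'P.
have -> : block_mx 1%:M r 0 1%:M =
    1%:M + (col_mx 1%:M 0 : 'cV_(1 + n.+1)) *m row_mx 0 r.
  rewrite mul_col_row !mul1mx !mul0mx scalar_mx_block add_block_mx.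
  by rewrite !addr0 add0r.
apply: positive_rank1_update.
have -> : row_mx 0 r *m (col_mx 1%:M 0 : 'cV_(1 + n.+1)) = 0.
  by rewrite mul_row_col mul0mx mulmx0 addr0.
by rewrite mxE; lra.
Qed.

End Positive.

(** * The index of a simplicial cone at a point *)

Section SegmentEnds.
Variables (R : realFieldType) (I : finType).
Implicit Types c k tau : I -> R.

(** General position of the line of direction [k] through [c]: it misses the
    coordinate subspaces of codimension two. *)
Definition generic_line c k : Prop :=
  forall t i j, c i + t * k i = 0 -> c j + t * k j = 0 -> i = j.

(** The parameter [- c j / k j] at which coordinate [j] vanishes is an end of
    the segment in which the line meets the positive orthant. *)
Definition segment_end c k j : bool :=
  (k j != 0) && [forall i, (i != j) ==> (0 < c i - c j / k j * k i)].

Lemma segment_endP c k j : reflect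
  (k j != 0 /\ forall i, i != j -> 0 < c i - c j / k j * k i) (segment_end c k j).
Proof.
apply: (iffP andP) => -[k0 H]; split=> //.
  by move=> i ij; have /forallP/(_ i)/implyP := H; exact.
by apply/forallP => i; apply/implyP/H.
Qed.

Lemma segment_endN c k : segment_end c (\- k) =1 segment_end c k.
Proof.
move=> j; rewrite /segment_end oppr_eq0; congr andb.
by apply: eq_forallb => i /=; rewrite invrN !mulrN mulNr opprK.
Qed.

Lemma segment_end_uniq c k i j : 0 < k i -> 0 < k j ->
  segment_end c k i -> segment_end c k j -> i = j.
Proof.
move=> ki kj /segment_endP[_ Hi] /segment_endP[_ Hj].
have [//|ij] := eqVneq i j; have := Hj i ij; rewrite eq_sym in ij.
have := Hi j ij; rewrite -(pmulr_rgt0 _ ki) -(pmulr_rgt0 (c i - _) kj).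
have -> : k i * (c j - c i / k i * k j) = k i * c j - c i * k j by field; lra.
have -> : k j * (c i - c j / k j * k i) = k j * c i - c j * k i by field; lra.
by move=> h1 h2; suff : 0 < 0 :> R; [rewrite ltxx | lra].
Qed.

(** The relation [sum_i k_i tau_i = 0] with [tau > 0] forces [k] to have entries
    of both signs, so the line leaves the orthant on both sides: the other end
    is the smallest parameter at which a decreasing coordinate vanishes. *)
Lemma segment_other_end c k tau j : generic_line c k ->
  (forall i, 0 < tau i) -> \sum_i k i * tau i = 0 ->
  0 < k j -> segment_end c k j ->
  exists2 i, k i < 0 & segment_end c k i.
Proof.
move=> gen tau0 sum0 kj /segment_endP[_ Hj].
have [i0 ki0] : exists i, k i < 0.
  apply/existsP; apply: contraT; rewrite negb_exists => /forallP kge.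
  suff : 0 < \sum_i k i * tau i by rewrite sum0 ltxx.
  rewrite (bigD1 j) //= ltr_pwDl ?mulr_gt0 //.
  by apply: sumr_ge0 => i _; rewrite mulr_ge0 ?(ltW (tau0 _)) // leNgt kge.
pose T i := - (c i / k i).
case: (@arg_minP _ _ _ i0 (fun i => k i < 0) T ki0) => i ki Ti.
have kin : k i != 0 by rewrite lt_eqF.
have kjn : k j != 0 by rewrite gt_eqF.
exists i => //; apply/segment_endP; split; first by rewrite lt_eqF.
have neg l : k l < 0 -> c l - c i / k i * k l = - k l * (T l - T i).
  by move=> kl; rewrite /T; field; rewrite kin lt_eqF.
have tji : T j < T i.
  have ij : i != j by apply: contraTneq ki => ->; rewrite -leNgt ltW.
  have := Hj i ij; rewrite (_ : c i - _ = - k i * (T i - T j)).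
    by rewrite pmulr_rgt0 ?oppr_gt0 // subr_gt0.
  by rewrite /T; field; rewrite ?kin ?kjn.
move=> l li; have [kl|kl] := ltP (k l) 0.
  have gei : 0 <= c l - c i / k i * k l.
    by rewrite neg // mulr_ge0 ?subr_ge0 ?Ti // oppr_ge0 ltW.
  rewrite lt_def gei andbT; apply: contra_neq li => E; apply: (gen (T i)).
    by rewrite /T mulNr.
  by rewrite /T mulNr divfK ?subrr.
have [->|lj] := eqVneq l j.
  rewrite (_ : _ - _ = k j * (T i - T j)); first by rewrite mulr_gt0 ?subr_gt0.
  by rewrite /T; field; rewrite ?kin ?kjn.
apply: lt_le_trans (Hj l lj) _.
by rewrite lerD2l lerN2 ler_wpM2r // -lerN2 ltW.
Qed.

(** A segment has exactly one end at which a coordinate increases from [0] and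
    exactly one at which a coordinate decreases to [0]; counted with opposite
    signs they cancel. *)
Lemma sum_segment_ends c k tau : generic_line c k ->
  (forall i, 0 < tau i) -> \sum_i k i * tau i = 0 ->
  \sum_i (if segment_end c k i then if 0 < k i then 1 else -1 else 0) = 0 :> rat.
Proof.
move=> gen tau0 sum0.
have genN : generic_line c (\- k).
  by move=> t i j; rewrite !mulrN -!mulNr; exact: gen.
have sum0N : \sum_i (\- k) i * tau i = 0.
  by under eq_bigr do rewrite /= mulNr; rewrite sumrN sum0 oppr0.
have uniqN i j : k i < 0 -> k j < 0 ->
    segment_end c k i -> segment_end c k j -> i = j.
  by move=> ki kj si sj; apply: (@segment_end_uniq c (\- k));
    rewrite ?segment_endN ?oppr_gt0.
have pair i j : 0 < k i -> k j < 0 -> segment_end c k i -> segment_end c k j ->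
    \sum_i (if segment_end c k i then if 0 < k i then 1 else -1 else 0) = 0 :> rat.
  move=> ki kj si sj; have ji : j != i.
    by apply: contraTneq kj => ->; rewrite -leNgt ltW.
  rewrite (bigD1 i) // (bigD1 j) //= si sj ki ltNge ltW //= big1 ?addr0 ?subrr //.
  move=> l /andP[li lj]; case: ifP => // sl.
  have /segment_endP[kl _] := sl; case: (ltrgtP 0 (k l)) kl => // kl _.
    by move: li; rewrite (segment_end_uniq kl ki sl si) eqxx.
  by move: lj; rewrite (uniqN _ _ kl kj sl sj) eqxx.
have [/existsP[j sj]|/existsPn ns] := boolP [exists j, segment_end c k j].
  have /segment_endP[kj _] := sj; case: (ltrgtP 0 (k j)) kj => // kj _.
    have [i ki si] := segment_other_end gen tau0 sum0 kj sj.
    exact: pair kj ki sj si.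
  have [|i] := segment_other_end genN tau0 sum0N _ (etrans (segment_endN c k j) sj).
    by rewrite /= oppr_gt0.
  rewrite /= segment_endN oppr_lt0 => ki si; exact: pair ki kj si sj.
by apply: big1 => i _; rewrite (negPf (ns i)).
Qed.

End SegmentEnds.

Section ConeIndex.
Variable R : realFieldType.

Definition in_open_cone d (xi : 'rV[R]_d) (N : 'M[R]_d) : bool :=
  (N \in unitmx) && [forall i, 0 < (xi *m invmx N) 0 i].

(** The local degree at [xi] of the oriented simplicial cone spanned by the rows
    of [N]. *)
Definition cone_index d (xi : 'rV[R]_d) (N : 'M[R]_d) : rat :=
  if in_open_cone xi N then if 0 < \det N then 1 else -1 else 0.

Lemma in_open_coneP d (xi : 'rV[R]_d) N : reflect
  (N \in unitmx /\ exists2 c : 'rV_d, (forall i, 0 < c 0 i) & c *m N = xi)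
  (in_open_cone xi N).
Proof.
apply: (iffP andP) => -[uN H]; split=> //.
  by exists (xi *m invmx N); [exact/forallP | rewrite mulmxKV].
by have [c c0 <-] := H; rewrite mulmxK //; apply/forallP.
Qed.

Lemma cone_index_eq0 d (xi : 'rV[R]_d) N : \det N = 0 -> cone_index xi N = 0.
Proof.
by move=> N0; rewrite /cone_index /in_open_cone unitmxE N0 unitr0.
Qed.

Lemma cone_index_row_perm d (xi : 'rV[R]_d) N (s : 'S_d) :
  cone_index xi (row_perm s N) = (-1) ^+ s * cone_index xi N.
Proof.
have dE : \det (row_perm s N) = (-1) ^+ s * \det N.
  by rewrite row_permE det_mulmx det_perm.
have [N0|N0] := eqVneq (\det N) 0.
  by rewrite !cone_index_eq0 ?mulr0 // dE N0 mulr0.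
have -> : cone_index xi (row_perm s N) =
    if in_open_cone xi N then if 0 < \det (row_perm s N) then 1 else -1 else 0.
  rewrite /cone_index; congr (if _ then _ else _).
  have cP (c : 'rV_d) : col_perm s c *m row_perm s N = c *m N.
    by rewrite col_permE row_permE mulmxA -(mulmxA c) -perm_mxM mulVg perm_mx1 mulmx1.
  apply/in_open_coneP/in_open_coneP => -[uN [c c0 cN]].
    split; first by rewrite unitmxE unitfE.
    exists (col_perm s^-1 c); first by move=> i; rewrite mxE.
    rewrite -cP -cN; congr (_ *m _); apply/rowP => i.
    by rewrite !mxE permK.
  split; first by rewrite unitmxE dE unitfE mulf_neq0 ?signr_eq0.
  exists (col_perm s c); first by move=> i; rewrite mxE.
  by rewrite cP.
rewrite /cone_index; case: ifP => _; last by rewrite mulr0.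
rewrite dE; case: (odd_perm s); rewrite ?expr0 ?expr1 ?mul1r //.
by rewrite mulN1r oppr_gt0; case: (ltrgtP (\det N) 0) N0.
Qed.

Lemma cone_index_diag_mul d (xi a : 'rV[R]_d) N : (forall i, 0 < a 0 i) ->
  cone_index xi (diag_mx a *m N) = cone_index xi N.
Proof.
move=> a0.
have da : 0 < \det (diag_mx a) by rewrite det_diag prodr_gt0.
have ua : diag_mx a \in unitmx by rewrite unitmxE unitfE gt_eqF.
rewrite /cone_index det_mulmx pmulr_rgt0 //; congr (if _ then _ else _).
apply/in_open_coneP/in_open_coneP; rewrite unitmx_mul ua /= => -[uN [c c0 cN]].
  split=> //; exists (c *m diag_mx a); last by rewrite -mulmxA.
  by move=> i; rewrite mul_mx_diag mxE mulr_gt0.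
split=> //; exists (\row_i (c 0 i / a 0 i)); first by move=> i; rewrite mxE divr_gt0.
rewrite mulmxA -cN; congr (_ *m _); apply/rowP => i.
by rewrite mul_mx_diag !mxE divfK ?gt_eqF.
Qed.

Lemma mul_row_del d (c : 'rV[R]_d.+1) (N : 'M[R]_(d.+1, d)) j :
  c *m N = c 0 j *: row j N + col' j c *m row' j N.
Proof.
apply/rowP => l; rewrite !mxE (bigD1_ord j) //=; congr (_ + _).
by apply: eq_bigr => i _; rewrite !mxE.
Qed.

(** Cramer's relation: for each column of [N], the expansion of the determinant
    of [N] with this column repeated. *)
Lemma signed_minors_ker d (N : 'M[R]_(d.+1, d)) :
  (\row_j ((-1) ^+ j * \det (row' j N))) *m N = 0.
Proof.
apply/rowP => l; rewrite mxE [RHS]mxE.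
pose B : 'M[R]_(d.+1, 1 + d) := row_mx (col l N) N.
have Br i j : B i (rshift 1 j) = N i j by rewrite /B row_mxEr.
have Bl i : B i (lshift d 0) = N i l by rewrite /B row_mxEl mxE.
have N_B : col' 0 B = N.
  by apply/matrixP => i j; rewrite mxE -Br; congr (B i _); exact: val_inj.
have B0 i : B i 0 = N i l by rewrite -Bl; congr (B i _); exact: val_inj.
have detB : \det (B : 'M_(1 + d)) = 0.
  rewrite -det_tr (@determinant_alternate _ _ _ (lshift d 0) (rshift 1 l)) //.
  by move=> i; rewrite mxE [RHS]mxE Bl Br.
rewrite -[RHS]detB (expand_det_col _ 0); apply: eq_bigr => i _.
by rewrite mxE B0 /cofactor addn0 N_B mulrC.
Qed.

(** The index is a cocycle.  If the [d + 1] rows of [N] span, the solutions [c]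
    of [c N = xi] form a line directed by the signed maximal minors [k] of [N];
    the cones omitting row [j] that contain [xi] are the ends of the segment of
    nonnegative solutions, with sign that of [k_j].  The functional [tau], positive
    on the rows, makes this segment bounded, and general position of [xi] keeps
    its two ends apart. *)
Lemma cone_index_boundary d (N : 'M[R]_(d.+1, d)) (xi : 'rV_d) (tau : 'cV_d) :
  (forall i, 0 < (N *m tau) i 0) ->
  (forall c : 'rV_d.+1, c *m N = xi ->
     forall i j, c 0 i = 0 -> c 0 j = 0 -> i = j) ->
  \sum_(j < d.+1) (-1) ^+ j * cone_index xi (row' j N) = 0.
Proof.
move=> tau0 gen.
set k : 'rV[R]_d.+1 := \row_j ((-1) ^+ j * \det (row' j N)).
have kN : k *m N = 0 := signed_minors_ker N.
have kE j : k 0 j = (-1) ^+ j * \det (row' j N) by rewrite mxE.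
have unit_j j : k 0 j != 0 -> row' j N \in unitmx.
  by rewrite kE mulf_eq0 signr_eq0 /= unitmxE unitfE.
have k_eq0 j : k 0 j = 0 -> cone_index xi (row' j N) = 0.
  by rewrite kE => /eqP; rewrite mulf_eq0 signr_eq0 /= => /eqP/cone_index_eq0.
move: k kN kE unit_j k_eq0 => k kN kE unit_j k_eq0.
have [/existsP[j0 kj0]|/existsPn k0] := boolP [exists j, k 0 j != 0]; last first.
  by apply: big1 => j _; rewrite k_eq0 ?mulr0 //; apply/eqP; have := k0 j; rewrite negbK.
have [c cN] : exists c : 'rV_d.+1, c *m N = xi.
  pose e := xi *m invmx (row' j0 N).
  exists (\row_i if unlift j0 i is Some i' then e 0 i' else 0).
  rewrite (mul_row_del _ _ j0) !mxE unlift_none scale0r add0r.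
  rewrite -[RHS](mulmxKV (unit_j _ kj0)); congr (_ *m _).
  by apply/rowP => i; rewrite 2!mxE liftK.
have line t : (c + t *: k) *m N = xi by rewrite mulmxDl -scalemxAl kN scaler0 addr0.
rewrite -[RHS](@sum_segment_ends R _ (c 0) (k 0) (fun i => (N *m tau) i 0)) //.
- apply: eq_bigr => j _; have [kj|kj] := eqVneq (k 0 j) 0.
    by rewrite k_eq0 // mulr0 /segment_end kj eqxx.
  set cj := c + (- (c 0 j / k 0 j)) *: k.
  have cjE i : cj 0 i = c 0 i - c 0 j / k 0 j * k 0 i by rewrite !mxE mulNr.
  have cjN : col' j cj *m row' j N = xi.
    by rewrite -(line (- (c 0 j / k 0 j))) (mul_row_del _ _ j) cjE divfK // subrr scale0r add0r.
  have -> : segment_end (c 0) (k 0) j = in_open_cone xi (row' j N).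
    rewrite /segment_end /in_open_cone kj unit_j //= -cjN mulmxK ?unit_j //.
    apply/forallP/forallP => H i.
      by have /implyP := H (lift j i); rewrite mxE cjE eq_sym neq_lift; exact.
    apply/implyP; rewrite eq_sym => /unlift_some[i' -> _].
    by have := H i'; rewrite mxE cjE.
  rewrite /cone_index; case: ifP => _; last by rewrite mulr0.
  move: kj; rewrite kE -signr_odd -[X in _ -> X * _ = _]signr_odd.
  case: (odd j); rewrite ?expr0 ?expr1 ?mul1r // mulN1r oppr_eq0 oppr_gt0.
  by case: (ltrgtP (\det _) 0).
- move=> t i j ci cj; apply: (gen _ (line t)); by rewrite !mxE.
- have := congr1 (fun B : 'rV_d => (B *m tau) 0 0) kN.
  by rewrite mul0mx -mulmxA [RHS]mxE mxE.
Qed.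

End ConeIndex.

Local Open Scope classical_set_scope.

(** * Points in general position *)

(** Equivalently, [xi] lies on no subspace spanned by [d - 1] of the [d + 1] rows
    of [N]. *)
Definition in_general_position (R : nzRingType) d (xi : 'rV[R]_d)
    (N : 'M[R]_(d.+1, d)) : Prop :=
  forall c : 'rV_d.+1, c *m N = xi ->
  forall i j, c 0 i = 0 -> c 0 j = 0 -> i = j.

(** The [d - 1] rows other than [i] and [j] do not span. *)
Lemma vanishing_functional (F : fieldType) d (N : 'M[F]_(d.+1, d)) i j : i != j ->
  exists2 u : 'cV_d, u != 0 & forall l, l != i -> l != j -> (N *m u) l 0 = 0.
Proof.
case: d N i j => [|d] N i j; first by rewrite !ord1 eqxx.
case/unlift_some => j' -> _.
pose N' : 'M[F]_(d, d.+1) := row' j' (row' i N).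
have : kermx N'^T != 0.
  by rewrite -mxrank_eq0 mxrank_ker -lt0n subn_gt0 (leq_ltn_trans (rank_leq_col _)).
case/rowV0Pn => v /sub_kermxP vN v0; exists v^T.
  by rewrite -trmx_eq0 trmxK.
move=> l; rewrite eq_sym => /unlift_some[l' -> _].
rewrite (inj_eq lift_inj) eq_sym => /unlift_some[l'' -> _].
have /rowP/(_ l'') := vN; rewrite mxE [RHS]mxE => E; rewrite mxE -[RHS]E.
by apply: eq_bigr => m _; rewrite !mxE mulrC.
Qed.

Lemma finite_roots (F : idomainType) (p : {poly F}) : p != 0 ->
  finite_set [set x | root p x].
Proof.
move=> p0; apply: contrapT => /(infinite_set_fset (size p))[B Bp].
apply/negP; rewrite -ltnNge; apply: max_poly_roots => //; last exact: fset_uniq.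
by apply/allP => x xB; apply: Bp.
Qed.

Lemma countable_avoid_pos (R : realType) (A : set R) : countable A ->
  exists2 x, 0 < x & ~ A x.
Proof.
move=> cA; apply: contrapT => H.
have sub : `]0, 1[%classic `<=` A.
  move=> x /=; rewrite in_itv /= => /andP[x0 _]; apply: contrapT => nAx.
  by apply: H; exists x.
have := countable_lebesgue_measure0 (sub_countable (subset_card_le sub) cA).
rewrite lebesgue_measure_itv /= lte_fin ltr01 oppr0 adde0 => /eqP.
by rewrite eqe oner_eq0.
Qed.

(** In the coordinates given by the rows of [B], a curve [(1, s, s^2, ...)] with
    [s > 0] stays in the open cone and meets a given hyperplane at finitely many
    [s], the roots of a nonzero polynomial.  Countably many hyperplanes exclude
    countably many [s] only. *)
Lemma exists_general_position (R : realType) d (B : 'M[R]_d) (I : countType)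
    (N : I -> 'M[R]_(d.+1, d)) : B \in unitmx ->
  exists2 c : 'rV[R]_d, (forall j, 0 < c 0 j) &
    forall a, in_general_position (c *m B) (N a).
Proof.
move=> uB; pose J := (I * 'I_d.+1 * 'I_d.+1)%type.
pose good (t : J) (p : {poly R}) := t.1.2 != t.2 -> p != 0 /\
  forall s (c : 'rV_d.+1), c *m N t.1.1 = (\row_(j < d) s ^+ j) *m B ->
    c 0 t.1.2 = 0 -> c 0 t.2 = 0 -> root p s.
have /choice[p pP] : forall t, exists p, good t p.
  move=> [[a i] j]; have [->|ij] := eqVneq i j; first by exists 0; rewrite /good /= eqxx.
  have [u u0 uN] := vanishing_functional (N a) ij.
  exists (rVpoly (B *m u)^T) => _ /=; split.
    apply: contra_neq u0 => /(congr1 (poly_rV (d := d))).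
    rewrite rVpolyK linear0 => /(congr1 trmx); rewrite trmxK trmx0 => Bu.
    by rewrite -[u](mulKmx uB) Bu mulmx0.
  move=> s c cN ci cj; apply/rootP.
  transitivity ((\row_(j < d) s ^+ j *m B *m u) 0 0).
    rewrite -mulmxA mxE horner_poly; apply: eq_bigr => l _.
    by rewrite valK mxE mulrC; congr (_ * _); exact: mxE.
  rewrite -cN -mulmxA mxE; apply: big1 => l _.
  have [->|li] := eqVneq l i; first by rewrite ci mul0r.
  have [->|lj] := eqVneq l j; first by rewrite cj mul0r.
  by rewrite uN // mulr0.
have cbad : countable (\bigcup_(t in [set t : J | t.1.2 != t.2]) [set x | root (p t) x]).
  apply: bigcup_countable => [|t /pP[p0 _]]; first exact: countableP.
  exact: finite_set_countable (finite_roots p0).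
have [s s0 snot] := countable_avoid_pos cbad.
exists (\row_(j < d) s ^+ j); first by move=> j; rewrite mxE exprn_gt0.
move=> a c cN i j ci cj; have [//|ij] := eqVneq i j.
exfalso; apply: snot; exists (a, i, j) => //=.
by have [_] := pP (a, i, j) ij; apply; first exact: cN.
Qed.

(** * Finiteness of the translates of a cone through a definite form *)

Lemma diag_form (F : comPzRingType) p (c w : 'rV[F]_p) :
  (w *m diag_mx c *m w^T) 0 0 = \sum_j c 0 j * w 0 j ^+ 2.
Proof.
rewrite mxE; apply: eq_bigr => j _.
by rewrite mul_mx_diag !mxE expr2 mulrCA mulrA.
Qed.

Lemma finite_bounded_mx n p (T : nat) :
  finite_set [set M : 'M[int]_(n, p) | forall i j, `|M i j| <= T%:Z].
Proof.
pose f (M : 'M['I_(T + T).+1]_(n, p)) : 'M[int]_(n, p) :=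
  \matrix_(i, j) ((M i j : nat)%:Z - T%:Z).
apply: sub_finite_set (finite_image f (@finite_finset _ setT)) => M MT.
exists (\matrix_(i, j) inord (absz (M i j + T%:Z))) => //.
apply/matrixP => i j; rewrite !mxE inordK; have := MT i j; lia.
Qed.

(** A definite form [x] lies in only finitely many of the cones spanned by the
    [g b g^T], [b] running over the rank one forms of the columns of [B].  If
    [x] has weights [c] in such a cone, consider the columns [J] of weight at
    least [eps].  If they did not span, some integral [u] would kill them, and
    the value of [x] at [u g^-1] would be at most [eps] times a constant
    depending only on [B], hence below the minimum [mu] of [x] for a good choice
    of [eps].  So they span, and the diagonal entries of [x] bound the entries of
    the columns of [g B] in [J], which determine [g]. *)
Lemma finite_cone_orbit (R : realType) n p (x : 'M[R]_n) (mu : R)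
    (B : 'M[int]_(n, p)) : 0 < mu ->
  (forall u : 'rV[int]_n, u != 0 ->
     mu <= (map_mx intr u *m x *m (map_mx intr u)^T) 0 0) ->
  finite_set [set g : 'M[int]_n | \det g = 1 /\
    exists2 c : 'rV[R]_p, (forall j, 0 <= c 0 j) &
      x = map_mx intr (g *m B) *m diag_mx c *m (map_mx intr (g *m B))^T].
Proof.
move=> mu0 xmu.
pose kills (J : {set 'I_p}) (u : 'rV[int]_n) :=
  u != 0 /\ forall j, j \in J -> (u *m B) 0 j = 0.
have /choice[u uP] : forall J, exists u, (exists v, kills J v) -> kills J u.
  move=> J; have [[v Jv]|nJ] := pselect (exists v, kills J v); first by exists v.
  by exists 0 => /nJ.
(* [K] bounds the error terms for all subsets [J] at once. *)
pose K : int := \sum_J \sum_j (u J *m B) 0 j ^+ 2.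
have K_ge J : \sum_j (u J *m B) 0 j ^+ 2 <= K.
  rewrite /K (bigD1 J) //= lerDl; apply: sumr_ge0 => J' _.
  by apply: sumr_ge0 => j _; exact: sqr_ge0.
have K0 : 0 <= K 
  by apply: sumr_ge0 => J _; apply: sumr_ge0 => j _; exact: sqr_ge0.
have K0R : 0 <= K%:~R :> R by rewrite ler0z.
pose eps : R := mu / (K%:~R + 1).
have eps0 : 0 < eps by rewrite divr_gt0 //; lra.
have epsK : eps * K%:~R < mu.
  rewrite /eps mulrAC ltr_pdivrMr ?ltr_pM2l //; lra.
pose T := Num.truncn (\sum_i `|x i i| / eps).
pose bounded (J : {set 'I_p}) : set 'M[int]_n :=
  [set g | ~ (exists v, kills J v) /\
           forall i j, j \in J -> `|(g *m B) i j| <= T.+1%:Z].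
apply: (@sub_finite_set _ _ (\bigcup_J bounded J)) => [g [detg [c c0 xE]]|].
  have formE (v : 'rV[int]_n) :
      (map_mx intr v *m x *m (map_mx intr v)^T) 0 0 =
      \sum_j c 0 j * ((v *m g *m B) 0 j)%:~R ^+ 2.
    rewrite {1}xE !mulmxA -map_mxM -mulmxA -trmx_mul -map_mxM mulmxA diag_form.
    by apply: eq_bigr => j _; rewrite mxE.
  pose J := [set j | eps <= c 0 j]%SET.
  have gU : g \in unitmx by rewrite unitmxE detg unitr1.
  exists J => //; split.
    move=> /uP[uJ0 uJ]; pose v := u J *m invmx g.
    have v0 : v != 0.
      by apply: contra_neq uJ0 => v0; rewrite -[u J](mulmxKV gU) -/v v0 mul0mx.
    suff H : \sum_j c 0 j * ((u J *m B) 0 j)%:~R ^+ 2 <= eps * K%:~R.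
      by have := xmu v v0; rewrite formE /v mulmxKV // leNgt (le_lt_trans H epsK).
    apply: (@le_trans _ _ (eps * (\sum_j (u J *m B) 0 j ^+ 2)%:~R)).
      rewrite rmorph_sum mulr_sumr; apply: ler_sum => j _; rewrite rmorphXn /=.
      have [jJ|] := boolP (j \in J).
        by rewrite uJ // mulr0z expr0n /= !mulr0.
      rewrite inE -ltNge => cj.
      by rewrite ler_wpM2r ?sqr_ge0 // ltW.
    by rewrite ler_wpM2l ?(ltW eps0) // ler_int K_ge.
  move=> i j; rewrite inE => cj.
  have xii : eps * ((g *m B) i j)%:~R ^+ 2 <= x i i.
    have -> : x i i = \sum_j c 0 j * (((delta_mx 0 i : 'rV_n) *m g *m B) 0 j)%:~R ^+ 2.
      by rewrite -formE map_delta_mx trmx_delta -rowE -colE !mxE.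
    apply: le_trans (_ : c 0 j * ((g *m B) i j)%:~R ^+ 2 <= _).
      by rewrite ler_wpM2r ?sqr_ge0.
    rewrite (bigD1 j) //= -rowE -row_mul [row i _ 0 j]mxE lerDl.
    by apply: sumr_ge0 => l _; rewrite mulr_ge0 ?sqr_ge0.
  have sq : ((g *m B) i j)%:~R ^+ 2 < T.+1%:R :> R.
    apply: (@le_lt_trans _ _ (\sum_i `|x i i| / eps)); last exact: truncnS_gt.
    rewrite (bigD1 i) //=; apply: (@le_trans _ _ (`|x i i| / eps)).
      by rewrite ler_pdivlMr // mulrC (le_trans xii) // ler_norm.
    by rewrite lerDl; apply: sumr_ge0 => l _; rewrite divr_ge0 // ltW.
  have {}sq : (g *m B) i j ^+ 2 < T.+1%:Z.
    by rewrite -(ltr_int R) rmorphXn.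
  nia.
apply: bigcup_finite => [|J _]; first exact: finite_finset.
have [kJ|nJ] := pselect (exists v, kills J v).
  by apply: sub_finite_set (finite_set0 _) => g [].
(* [g] is determined by its action on the spanning set of columns [J]. *)
pose f (g : 'M[int]_n) := \matrix_(i, j) (if j \in J then (g *m B) i j else 0).
apply: sub_finite_set (finite_preimage (f := f) _ (@finite_bounded_mx n p T.+1)).
  move=> g [_ gT] i j; rewrite mxE; case: ifP => [jJ|_]; first exact: gT.
  by rewrite normr0.
move=> g1 g2 _ _ f12; apply/eqP; rewrite -subr_eq0; apply/eqP/row_matrixP => i.
apply: contrapT => /eqP gi; apply: nJ; exists (row i (g1 - g2)); split.
  by apply: contra gi => /eqP ->; rewrite row0.
move=> j jJ; rewrite -row_mul mulmxBl mxE.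
have /matrixP/(_ i j) := f12; rewrite mxE jJ [RHS]mxE jJ => E.
by rewrite mxE [X in _ + X]mxE E subrr.
Qed.

(** * The root lattice form is perfect *)

Section RootLattice.
Variable n : nat.
Implicit Types v : 'cV[int]_n.

(** The norm of the root lattice [A_n] in the basis [e_i - e_(n+1)], in which
    the last coordinate of [v] is minus the sum of the others. *)
Definition root_norm v : int := \sum_i v i 0 ^+ 2 + (\sum_i v i 0) ^+ 2.

(** The roots of [A_n], up to sign: the case [p.1 = p.2] stands for the roots
    involving the eliminated coordinate. *)
Definition root_vec (p : 'I_n * 'I_n) : 'cV[int]_n :=
  if p.1 == p.2 then delta_mx p.1 0 else delta_mx p.1 0 - delta_mx p.2 0.

Lemma root_vec_neq0 p : root_vec p != 0.
Proof.
case: p => i j; rewrite /root_vec /=; apply/eqP => /colP/(_ i).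
by case: eqVneq => [->|ij]; rewrite !mxE ?eqxx // (negPf ij).
Qed.

Lemma sum_delta_col (i : 'I_n) :
  \sum_l (delta_mx i 0 : 'cV[int]_n) l 0 = 1.
Proof.
rewrite (bigD1 i) //= mxE !eqxx big1 ?addr0 // => l li.
by rewrite mxE (negPf li).
Qed.

Lemma root_norm_root p : root_norm (root_vec p) = 2.
Proof.
case: p => i j; rewrite /root_norm /root_vec /=; have [_|ij] := eqVneq i j.
  rewrite sum_delta_col (bigD1 i) //= mxE !eqxx big1 // => l li.
  by rewrite mxE (negPf li).
have -> : \sum_l (delta_mx i 0 - delta_mx j 0 : 'cV[int]_n) l 0 = 0.
  under eq_bigr do rewrite mxE [X in _ + X]mxE.
  by rewrite big_split sumrN /= !sum_delta_col subrr.
rewrite (bigD1 i) // (bigD1 j) ?(eq_sym j) //= !mxE !eqxx (negPf ij) eq_sym (negPf ij).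
rewrite big1 // => l /andP[li lj].
by rewrite !mxE (negPf li) (negPf lj).
Qed.

Lemma root_normN v : root_norm (- v) = root_norm v.
Proof.
rewrite /root_norm; congr (_ + _).
  by apply: eq_bigr => i _; rewrite mxE sqrrN.
under eq_bigr do rewrite mxE.
by rewrite sumrN sqrrN.
Qed.

Lemma sum_sq_entries_le v (s : seq 'I_n) : uniq s ->
  \sum_(i <- s) v i 0 ^+ 2 <= \sum_i v i 0 ^+ 2.
Proof.
move=> us; rewrite big_uniq // [leRHS](bigID (mem s)) /= lerDl.
by apply: sumr_ge0 => i _; exact: sqr_ge0.
Qed.

Lemma exists_nonzero_entry v : v != 0 -> exists i, v i 0 != 0.
Proof.
move=> v0; apply/existsP; apply: contraNT v0; rewrite negb_exists => /forallP v0.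
by apply/eqP/colP => i; rewrite mxE; apply/eqP; have := v0 i; rewrite negbK.
Qed.

Lemma sum0_sign_change v : v != 0 -> \sum_i v i 0 = 0 ->
  exists i j, 0 < v i 0 /\ v j 0 < 0.
Proof.
move=> v0 s0.
have pos (w : 'cV[int]_n) : w != 0 -> \sum_i w i 0 = 0 -> exists i, 0 < w i 0.
  move=> w0 ws; apply/existsP; apply: contraNT w0; rewrite negb_exists => /forallP wle.
  apply/eqP/colP => i; rewrite mxE; apply/eqP; rewrite -oppr_eq0.
  have /psumr_eq0P -> // : \sum_i - w i 0 = 0 by rewrite sumrN ws oppr0.
  by move=> l _; rewrite oppr_ge0 leNgt.
have [i vi] := pos v v0 s0.
have [||j vj] := pos (- v); first by rewrite oppr_eq0.
  by under eq_bigr do rewrite mxE; rewrite sumrN s0 oppr0.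
by exists i, j; split=> //; move: vj; rewrite mxE oppr_gt0.
Qed.

(** A nonzero integral vector with coordinates of sum zero has at least two
    nonzero coordinates; in the eliminated form, either the sum of [v] is zero and
    [v] has entries of both signs, or the sum itself contributes. *)
Lemma root_norm_ge2 v : v != 0 -> 2 <= root_norm v.
Proof.
move=> v0; rewrite /root_norm.
have [s0|s0] := eqVneq (\sum_i v i 0) 0.
  have [i [j [vi vj]]] := sum0_sign_change v0 s0; rewrite s0 expr0n addr0.
  have ij : i != j by apply: contraTneq vj => <-; rewrite -leNgt ltW.
  have := @sum_sq_entries_le v [:: i; j]; rewrite /= inE ij => /(_ isT).
  by rewrite !big_cons big_nil !expr2; apply: le_trans; nia.
have [i vi] := exists_nonzero_entry v0.
have := @sum_sq_entries_le v [:: i] isT; rewrite big_seq1.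
move: (\sum_i v i 0) (\sum_i v i 0 ^+ 2) s0 => a b; rewrite !expr2; nia.
Qed.

Lemma root_norm_le2 v : v != 0 -> root_norm v <= 2 ->
  exists p, v = root_vec p \/ v = - root_vec p.
Proof.
move=> v0; rewrite /root_norm.
have [s0|s0] := eqVneq (\sum_i v i 0) 0.
  have [i [j [vi vj]]] := sum0_sign_change v0 s0.
  rewrite s0 expr0n addr0 => le2.
  have ij : i != j by apply: contraTneq vj => <-; rewrite -leNgt ltW.
  exists (i, j); left; rewrite /root_vec /= (negPf ij).
  have two : v i 0 ^+ 2 + v j 0 ^+ 2 <= 2.
    have := @sum_sq_entries_le v [:: i; j]; rewrite /= inE ij => /(_ isT).
    by rewrite !big_cons big_nil addr0 => /le_trans; apply.
  apply/colP => l; rewrite !mxE eqxx !andbT.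
  have [->|li] := eqVneq l i.
    by rewrite (negPf ij) subr0; move: two; rewrite !expr2; nia.
  have [->|lj] := eqVneq l j.
    by rewrite sub0r; move: two; rewrite !expr2; nia.
  have three : v i 0 ^+ 2 + (v j 0 ^+ 2 + v l 0 ^+ 2) <= 2.
    have := @sum_sq_entries_le v [:: i; j; l].
    rewrite /= !inE negb_or ij (eq_sym i l) (eq_sym j l) li lj => /(_ isT).
    by rewrite !big_cons big_nil addr0 => /le_trans; apply.
  by rewrite subrr; move: three; rewrite !expr2; nia.
have [i vi] := exists_nonzero_entry v0.
move=> le2; have le1 : \sum_i v i 0 ^+ 2 <= 1.
  by move: (\sum_i v i 0) (\sum_i v i 0 ^+ 2) s0 le2 => a b; rewrite expr2; nia.
have one l : l != i -> v i 0 ^+ 2 + v l 0 ^+ 2 <= 1.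
  move=> li; have := @sum_sq_entries_le v [:: i; l].
  rewrite /= inE eq_sym li => /(_ isT).
  by rewrite !big_cons big_nil addr0 => /le_trans; apply.
have vE : v = v i 0 *: delta_mx i 0.
  apply/colP => l; rewrite !mxE; have [->|li] := eqVneq l i.
    by rewrite eqxx mulr1.
  by have := one l li; rewrite mulr0 !expr2; nia.
exists (i, i); rewrite /root_vec /= eqxx.
have := @sum_sq_entries_le v [:: i] isT; rewrite big_seq1 => /le_trans/(_ le1).
rewrite expr2 => vi1; have : v i 0 = 1 \/ v i 0 = -1 by nia.
by case=> E; [left | right]; rewrite vE E ?scale1r ?scaleN1r.
Qed.

End RootLattice.

(** The identity [sum y_ij (e_i - e_j)(e_i - e_j)^T = 2 diag(row sums of y) - 2 y]
    for a symmetric [y]; it expresses [y] in the rank one forms of the roots. *)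
Lemma sum_coord_diff (F : comNzRingType) n (y : 'M[F]_n) : y^T = y ->
  \sum_i \sum_j y i j *:
    (delta_mx i i + delta_mx j j - delta_mx i j - delta_mx j i : 'M_n) =
  (\sum_i (\sum_j y i j) *: delta_mx i i) *+ 2 - y *+ 2.
Proof.
move=> yT; have sy i j : y i j = y j i by rewrite -{1}yT mxE.
under eq_bigr => i _ do under eq_bigr => j _ do rewrite !scalerDr !scalerN.
under eq_bigr => i _ do rewrite !big_split /= !sumrN -scaler_suml.
have sum_jj : \sum_i \sum_j y i j *: delta_mx j j =
    \sum_i (\sum_j y i j) *: delta_mx i i :> 'M_n.
  rewrite exchange_big; apply: eq_bigr => i _; rewrite scaler_suml.
  by apply: eq_bigr => j _; rewrite sy.
have sum_ji : \sum_i \sum_j y i j *: delta_mx j i = y.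
  rewrite exchange_big [RHS]matrix_sum_delta; apply: eq_bigr => i _.
  by apply: eq_bigr => j _; rewrite sy.
rewrite !big_split /= !sumrN sum_jj sum_ji -matrix_sum_delta.
by rewrite -addrA -opprD !mulr2n.
Qed.

Section RootTile.
Variables (R : realType) (n : nat).

Definition root_form : 'M[R]_n := 1%:M + const_mx 1.

Lemma root_formE (x : 'cV[R]_n) :
  qform root_form x = \sum_i x i 0 ^+ 2 + (\sum_i x i 0) ^+ 2.
Proof.
have J1 : const_mx 1 = (const_mx 1 : 'cV[R]_n) *m (const_mx 1 : 'rV[R]_n).
  by apply/matrixP => i j; rewrite !mxE big_ord1 !mxE mulr1.
rewrite /qform /root_form mulmxDr mulmx1 mulmxDl mxE; congr (_ + _).
  by rewrite mxE; apply: eq_bigr => i _; rewrite mxE.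
rewrite J1 mulmxA -mulmxA mxE big_ord1 expr2; congr (_ * _); rewrite mxE.
  by apply: eq_bigr => i _; rewrite !mxE mulr1.
by apply: eq_bigr => i _; rewrite !mxE mul1r.
Qed.

Lemma root_form_int (v : 'cV[int]_n) :
  qform root_form (map_mx intr v) = (root_norm v)%:~R.
Proof.
rewrite root_formE rmorphD rmorph_sum rmorphXn rmorph_sum /=; congr (_ + _ ^+ 2).
  by apply: eq_bigr => i _; rewrite mxE rmorphXn.
by apply: eq_bigr => i _; rewrite mxE.
Qed.

Definition root_mx : 'M[int]_(n, #|{: 'I_n * 'I_n}|) :=
  \matrix_(i, j) root_vec (enum_val j) i 0.

Lemma col_root_mx j : col j root_mx = root_vec (enum_val j).
Proof. by apply/colP => i; rewrite !mxE. Qed.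

Lemma minimal_root_form v :
  minimal_vector root_form v <->
  exists j, v = col j root_mx \/ v = - col j root_mx.
Proof.
split=> [[v0 vmin]|[j vj]].
  have [i _] := exists_nonzero_entry v0.
  have := vmin _ (root_vec_neq0 (i, i)); rewrite !root_form_int root_norm_root.
  rewrite ler_int => /(root_norm_le2 v0)[p pE].
  by exists (enum_rank p); rewrite col_root_mx enum_rankK.
have Nv : root_norm v = 2.
  by case: vj => ->; rewrite ?root_normN col_root_mx root_norm_root.
split; first by case: vj => ->; rewrite ?oppr_eq0 col_root_mx root_vec_neq0.
by move=> w w0; rewrite !root_form_int ler_int Nv root_norm_ge2.
Qed.

Lemma rank_one_sym (v : 'cV[rat]_n) : rank_one R v \in symY R n.
Proof. by rewrite mem_symY /rank_one map_trmx trmx_mul trmxK. Qed.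

Lemma rank_one_root (p : 'I_n * 'I_n) : rank_one R (map_mx intr (root_vec p)) =
  if p.1 == p.2 then delta_mx p.1 p.1 else
  delta_mx p.1 p.1 + delta_mx p.2 p.2 - delta_mx p.1 p.2 - delta_mx p.2 p.1.
Proof.
case: p => i j; rewrite /root_vec /rank_one /=.
have dd k l : delta_mx k 0 *m delta_mx 0 l = delta_mx k l :> 'M[rat]_n.
  by rewrite mul_delta_mx.
case: eqVneq => _; first by rewrite map_delta_mx trmx_delta dd map_delta_mx.
rewrite map_mxB !map_delta_mx linearB /= !trmx_delta mulmxBl !mulmxBr !dd.
rewrite !map_mxB !map_delta_mx.
by apply/matrixP => k l; rewrite !mxE; ring.
Qed.

Lemma span_rank_one_root :
  <<[seq rank_one R (col j (map_mx intr root_mx)) | j <- enum 'I_(_)]>>%VS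
  = symY R n.
Proof.
set X := map _ _.
have X_root p : rank_one R (map_mx intr (root_vec p)) \in <<X>>%VS.
  apply: memv_span; apply/mapP; exists (enum_rank p); first by rewrite mem_enum.
  by rewrite -map_col col_root_mx enum_rankK.
apply/eqP; rewrite eqEsubv; apply/andP; split.
  by apply/span_subvP => _ /mapP[j _ ->]; exact: rank_one_sym.
have X_diag i : delta_mx i i \in <<X>>%VS.
  by have := X_root (i, i); rewrite rank_one_root /= eqxx.
apply/subvP => y; rewrite mem_symY => /eqP/sum_coord_diff yE.
have -> : y = \sum_i (\sum_j y i j) *: delta_mx i i - 2^-1 *:
    (\sum_i \sum_j y i j *:
      (delta_mx i i + delta_mx j j - delta_mx i j - delta_mx j i)).
  have half2 (v : 'M[R]_n) : 2^-1 *: (v *+ 2) = v.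
    by rewrite -(scaler_nat 2 v) scalerA mulVf ?scale1r // pnatr_eq0.
  by rewrite yE -mulrnBl half2 subKr.
rewrite rpredB ?rpredZ // rpred_sum // => i _; first by rewrite rpredZ.
rewrite rpred_sum // => j _; rewrite rpredZ //.
have := X_root (i, j); rewrite rank_one_root /=; case: eqVneq => // -> _.
by rewrite addrK subrr rpred0.
Qed.

(** The form [A_n] is perfect, since its minimal vectors are the roots and their
    rank one forms span.  Without a tile the cycle would be zero. *)
Lemma tile_exists : exists T : set 'M[R]_n, tile T.
Proof.
exists (@cone R n _ (map_mx intr root_mx)).
exists root_form, #|{: 'I_n * 'I_n}|, root_mx; split=> //.
- split=> [|x x0].
    rewrite mem_symY /root_form linearD /= trmx1; apply/eqP; congr (_ + _).
    by apply/matrixP => i j; rewrite !mxE.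
  rewrite root_formE lt_neqAle addr_ge0 ?sqr_ge0 ?sumr_ge0 // => [|i _]; last exact: sqr_ge0.
  rewrite andbT eq_sym; apply: contra x0.
  rewrite paddr_eq0 ?sqr_ge0 ?sumr_ge0 // => [/andP[/eqP H _]|i _]; last exact: sqr_ge0.
  apply/eqP/colP => i; rewrite mxE; apply/eqP; rewrite -sqrf_eq0; apply/eqP.
  by have /psumr_eq0P -> := H; move=> // l _; exact: sqr_ge0.
- exact: minimal_root_form.
- exact: span_rank_one_root.
Qed.

End RootTile.

(** * Symmetric matrices in coordinates *)

Section Frame.
Variables (R : realType) (n d : nat) (E : d.-tuple 'M[R]_n).
Hypothesis hE : basis_of (symY R n) E.

Definition sym_coords (y : 'M[R]_n) : 'rV[R]_d := \row_j coord E j y.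

(** The rows are the coordinates of the rank one forms [v_i v_i^T] of the columns
    [v_i] of [A], so that the sign of the determinant is the orientation of the
    cone. *)
Definition frame p (A : 'M[rat]_(n, p)) : 'M[R]_(p, d) :=
  \matrix_(i, j) coord E j (rank_one R (col i A)).

(** The form [sum_i c_i v_i v_i^T] in the cone of the columns [v_i] of [A]. *)
Definition gram p (c : 'rV[R]_p) (A : 'M[rat]_(n, p)) : 'M[R]_n :=
  map_mx ratr A *m diag_mx c *m (map_mx ratr A)^T.

Lemma sym_coordsK y : y \in symY R n -> \sum_j sym_coords y 0 j *: E`_j = y.
Proof.
by move=> yS; rewrite [RHS](coord_basis hE yS); apply: eq_bigr => j _; rewrite mxE.
Qed.

Lemma sym_coords_inj : {in symY R n &, injective sym_coords}.
Proof. by move=> x y xS yS xy; rewrite -(sym_coordsK xS) xy sym_coordsK. Qed.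

Lemma gramE p (c : 'rV[R]_p) A : gram c A = \sum_i c 0 i *: rank_one R (col i A).
Proof.
apply/matrixP => k l; rewrite summxE mxE; apply: eq_bigr => i _.
by rewrite mul_mx_diag !mxE big_ord1 !mxE rmorphM mulrAC mulrC.
Qed.

Lemma gram_sym p (c : 'rV[R]_p) A : gram c A \in symY R n.
Proof.
by rewrite gramE rpred_sum // => i _; rewrite rpredZ // rank_one_sym.
Qed.

Lemma mul_frame p (c : 'rV[R]_p) A : c *m frame A = sym_coords (gram c A).
Proof.
apply/rowP => j; rewrite !mxE gramE linear_sum; apply: eq_bigr => i _.
by rewrite linearZ !mxE.
Qed.

(** Evaluation of the linear form [y |-> tr (Q y)] on the rank one forms of [A],
    in coordinates.  It is used with [Q = 1], positive on all rank one forms, and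
    with [Q = w^T w], for which [tr (Q y) = w y w^T]. *)
Lemma frame_tr p (A : 'M[rat]_(n, p)) (Q : 'M[R]_n) i :
  (frame A *m (\col_j \tr (Q *m E`_j))) i 0 = \tr (Q *m rank_one R (col i A)).
Proof.
rewrite mxE -[in RHS](sym_coordsK (rank_one_sym R (col i A))).
rewrite mulmx_sumr linear_sum; apply: eq_bigr => j _.
by rewrite -scalemxAr linearZ !mxE.
Qed.

Lemma frame_col_perm p (A : 'M[rat]_(n, p)) (s : 'S_p) :
  frame (col_perm s A) = row_perm s (frame A).
Proof.
apply/matrixP => i j; rewrite !mxE; congr (coord E j (rank_one _ _)).
by apply/colP => k; rewrite !mxE.
Qed.

Lemma frame_col' p (A : 'M[rat]_(n, p)) (i0 : 'I_p) :
  frame (col' i0 A) = row' i0 (frame A).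
Proof.
apply/matrixP => i j; rewrite !mxE; congr (coord E j (rank_one _ _)).
by apply/colP => k; rewrite !mxE.
Qed.

Lemma frame_scale p (A B : 'M[rat]_(n, p)) (a : 'I_p -> rat) :
  (forall i j, B i j = a j * A i j) ->
  frame B = diag_mx (\row_j ratr (a j) ^+ 2) *m frame A.
Proof.
move=> BA; rewrite mul_diag_mx; apply/matrixP => i j; rewrite !mxE.
have -> : rank_one R (col i B) = ratr (a i) ^+ 2 *: rank_one R (col i A).
  apply/matrixP => k l; rewrite !mxE !big_ord1 !mxE !BA !rmorphM expr2.
  by rewrite mulrACA.
by rewrite linearZ.
Qed.

(** Each basis element [E_i] is a combination of the rank one forms, with
    coefficients read off the inverse of the frame. *)
Lemma frame_row_unit_span (A : 'M[rat]_(n, d)) (U : {vspace 'M[R]_n}) :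
  frame A \in unitmx -> (forall j, rank_one R (col j A) \in U) ->
  (symY R n <= U)%VS.
Proof.
move=> uA AU; rewrite -(span_basis hE); apply/span_subvP => _ /tnthP[i ->].
have -> : tnth E i = gram (row i (invmx (frame A))) A.
  apply: sym_coords_inj; [by rewrite (basis_mem hE) // mem_tnth | exact: gram_sym |].
  rewrite -mul_frame -row_mul mulVmx //; apply/rowP => j.
  by rewrite !mxE (tnth_nth 0) coord_free ?(basis_free hE).
by rewrite gramE rpred_sum // => j _; rewrite rpredZ.
Qed.

Lemma det_frame_in_subspace (A : 'M[rat]_(n, d)) (U : {vspace 'M[R]_n}) :
  (\dim U < d)%N -> (forall j, rank_one R (col j A) \in U) -> \det (frame A) = 0.
Proof.
move=> Ud AU; apply/eqP; apply: contraLR Ud => uA; rewrite -leqNgt.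
rewrite -[X in (X <= _)%N](size_basis hE) dimvS //.
by apply: frame_row_unit_span AU; rewrite unitmxE unitfE.
Qed.

Lemma ratr_mx_eq0 k l (A : 'M[rat]_(k, l)) : (map_mx (ratr : rat -> R) A == 0) = (A == 0).
Proof. exact: map_mx_eq0. Qed.

(** If [u] kills all columns of [A], the nonzero linear form [y |-> u y u^T] kills
    their rank one forms. *)
Lemma det_frame_nonspanning (A : 'M[rat]_(n, d)) :
  (\rank A < n)%N -> \det (frame A) = 0.
Proof.
move=> rA; apply/eqP; rewrite -[_ == 0]negbK -unitfE -unitmxE; apply/negP => uA.
have /rowV0Pn[u /sub_kermxP uA0 u0] : kermx A != 0.
  by rewrite -mxrank_eq0 mxrank_ker -lt0n subn_gt0.
pose w : 'rV[R]_n := map_mx ratr u.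
pose Q := w^T *m w.
have QA j : \tr (Q *m rank_one R (col j A)) = 0.
  rewrite /Q /rank_one map_mxM -mulmxA (mulmxA w) -map_mxM.
  by rewrite colE (mulmxA u) uA0 mul0mx map_mx0 mul0mx mulmx0 mxtrace0.
have QE0 : (\col_j \tr (Q *m E`_j)) = 0 :> 'cV_d.
  rewrite -[LHS](mulKmx uA) (_ : frame A *m _ = 0) ?mulmx0 //.
  by apply/colP => j; rewrite frame_tr QA mxE.
have QS y : y \in symY R n -> \tr (Q *m y) = 0.
  move=> yS; rewrite -(sym_coordsK yS) mulmx_sumr linear_sum big1 // => j _.
  have /colP/(_ j) := QE0; rewrite !mxE => Ej.
  by rewrite -scalemxAr linearZ /= Ej mulr0.
have QQ : Q \in symY R n by rewrite mem_symY /Q trmx_mul trmxK.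
have : w *m w^T = 0.
  have wE := mx11_scalar (w *m w^T).
  have := QS _ QQ; rewrite /Q -mulmxA (mulmxA w) wE mul_scalar_mx -scalemxAr.
  rewrite linearZ /= mxtrace_mulC wE mxtrace_scalar [_%:M 0 0]mxE mulr1n => /eqP.
  by rewrite mulf_eq0 orbb => /eqP w0; rewrite w0 raddf0.
move=> /matrixP/(_ 0 0); rewrite !mxE => /psumr_eq0P ww0.
case/negP: u0; rewrite -ratr_mx_eq0; apply/eqP/rowP => k; rewrite [RHS]mxE.
apply/eqP; rewrite -sqrf_eq0 expr2; apply/eqP.
have := ww0 _ k isT; rewrite !mxE; apply=> i _.
by rewrite !mxE -expr2 sqr_ge0.
Qed.

Lemma frame_trace_gt0 p (A : 'M[rat]_(n, p)) i : col i A != 0 ->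
  0 < (frame A *m (\col_j \tr (1%:M *m E`_j))) i 0.
Proof.
move=> Ai; rewrite frame_tr mul1mx /rank_one map_mxM mxtrace_mulC trace_mx11 mxE.
rewrite lt_def sumr_ge0 ?andbT => [|k _]; last by rewrite !mxE -expr2 sqr_ge0.
apply: contra Ai => /eqP/psumr_eq0P sum0.
rewrite -ratr_mx_eq0; apply/eqP/colP => k; rewrite [RHS]mxE.
apply/eqP; rewrite -sqrf_eq0 expr2; apply/eqP.
have := sum0 _ k isT; rewrite !mxE; apply=> l _.
by rewrite !mxE -expr2 sqr_ge0.
Qed.

(** The matrix of [y |-> g y g^T] on the symmetric matrices, acting on row
    vectors. *)
Definition sym_action (g : 'M[R]_n) : 'M[R]_d :=
  \matrix_(i, j) coord E j (g *m E`_i *m g^T).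

Lemma conj_sym (g y : 'M[R]_n) : y \in symY R n -> g *m y *m g^T \in symY R n.
Proof.
by rewrite !mem_symY !trmx_mul trmxK mulmxA => /eqP ->.
Qed.

Lemma basis_sym (i : 'I_d) : E`_i \in symY R n.
Proof. by rewrite (basis_mem hE) // mem_nth // size_tuple. Qed.

Lemma sym_actionE (g y : 'M[R]_n) : y \in symY R n ->
  sym_coords (g *m y *m g^T) = sym_coords y *m sym_action g.
Proof.
move=> yS; rewrite -{1}(sym_coordsK yS) mulmx_sumr mulmx_suml.
apply/rowP => j; rewrite !mxE linear_sum; apply: eq_bigr => i _.
by rewrite -scalemxAr -scalemxAl linearZ !mxE.
Qed.

Lemma sym_actionM (g h : 'M[R]_n) :
  sym_action (g *m h) = sym_action h *m sym_action g.
Proof.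
apply/row_matrixP => i; rewrite row_mul.
have rowE k : row i (sym_action k) = sym_coords (k *m E`_i *m k^T).
  by apply/rowP => j; rewrite !mxE.
rewrite !rowE -sym_actionE ?conj_sym ?basis_sym //.
by rewrite trmx_mul !mulmxA.
Qed.

Lemma sym_action1 : sym_action 1%:M = 1%:M.
Proof.
apply/matrixP => i j; rewrite !mxE trmx1 mulmx1 mul1mx.
by rewrite coord_free ?(basis_free hE).
Qed.

(** Matrices of positive determinant preserve the orientation of the space of
    symmetric matrices: the determinant of their action is a multiplicative
    character, and they are products of squares. *)
Lemma det_sym_action_gt0 (g : 'M[R]_n) : 0 < \det g -> 0 < \det (sym_action g).
Proof.
move=> g0; apply: (det_gt0_positive_mx g0 (chi := fun g => \det (sym_action g))).
by split=> [a b|]; rewrite ?sym_actionM ?det_mulmx 1?mulrC // sym_action1 det1.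
Qed.

Lemma frame_mul p (g : 'M[rat]_n) (A : 'M[rat]_(n, p)) :
  frame (g *m A) = frame A *m sym_action (map_mx ratr g).
Proof.
apply/row_matrixP => i; rewrite row_mul.
have rowE (B : 'M[rat]_(n, p)) : row i (frame B) = sym_coords (rank_one R (col i B)).
  by apply/rowP => j; rewrite !mxE.
rewrite !rowE -sym_actionE ?rank_one_sym //; congr sym_coords.
have -> : col i (g *m A) = g *m col i A by rewrite !colE mulmxA.
by rewrite /rank_one trmx_mul !map_mxM map_trmx !mulmxA.
Qed.

End Frame.

Lemma clear_denominators n p (A : 'M[rat]_(n, p)) :
  exists2 N : nat, (0 < N)%N & exists B : 'M[int]_(n, p),
    A = (N%:R)^-1 *: map_mx intr B.
Proof.
pose D : int := \prod_(ij : 'I_n * 'I_p) denq (A ij.1 ij.2).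
have D0 : 0 < D by apply: prodr_gt0 => ij _; exact: denq_gt0.
exists (absz D); first by rewrite absz_gt0 gt_eqF.
have DE : (absz D)%:R = D%:~R :> rat by rewrite -{2}(gez0_abs (ltW D0)).
pose b i j := numq (A i j) * \prod_(ij : 'I_n * 'I_p | ij != (i, j)) denq (A ij.1 ij.2).
exists (\matrix_(i, j) b i j); apply/matrixP => i j; rewrite !mxE DE.
apply: (canRL (mulKf _)); first by rewrite intr_eq0 gt_eqF.
rewrite /D (bigD1 (i, j)) //= !rmorphM /= numqE.
by rewrite mulrC mulrA.
Qed.

(** * The degree of a sharbly *)

Section Finiteness.
Variables (R : realType) (n : nat).

Lemma gram_int p (c : 'rV[R]_p) (a : rat) (B : 'M[int]_(n, p)) :
  gram c (a *: map_mx intr B) =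
  map_mx intr B *m diag_mx (ratr a ^+ 2 *: c) *m (map_mx intr B)^T.
Proof.
rewrite /gram.
have -> : map_mx ratr (a *: map_mx intr B) = ratr a *: map_mx intr B :> 'M[R]_(n, p).
  by apply/matrixP => i j; rewrite !mxE rmorphM /= ratr_int.
rewrite [diag_mx (_ *: _)]linearZ /= linearZ /= -!scalemxAl -!scalemxAr.
by rewrite -scalemxAl scalerA expr2.
Qed.

(** The value at [u] is a sum of squares of integers with positive weights, not
    all zero because the columns of [A] span; so the smallest weight is a lower
    bound.  The inverse of one plus the sum of their inverses is below all the
    weights. *)
Lemma gram_lattice_min p (c : 'rV[R]_p) (A : 'M[rat]_(n, p)) :
  (forall j, 0 < c 0 j) -> (n <= \rank A)%N ->
  exists2 mu : R, 0 < mu & forall u : 'rV[int]_n, u != 0 ->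
    mu <= (map_mx intr u *m gram c A *m (map_mx intr u)^T) 0 0.
Proof.
move=> c0 rA; have [N N0 [B AB]] := clear_denominators A.
pose e : 'rV[R]_p := ratr (N%:R^-1) ^+ 2 *: c.
have e0 j : 0 < e 0 j.
  rewrite mxE mulr_gt0 // exprn_gt0 // ltr0q invr_gt0 ltr0n //.
have S0 : 0 <= \sum_j (e 0 j)^-1 by apply: sumr_ge0 => j _; rewrite invr_ge0 ltW.
pose S : R := 1 + \sum_j (e 0 j)^-1; have S1 : 0 < S by rewrite /S; lra.
exists S^-1; first by rewrite invr_gt0.
move=> u u0; rewrite AB gram_int -/e !mulmxA -map_mxM -mulmxA -trmx_mul -map_mxM.
rewrite diag_form.
have [j uBj] : exists j, (u *m B) 0 j != 0.
  apply/existsP; apply: contraNT u0; rewrite negb_exists => /forallP uB0.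
  have uB : u *m B = 0.
    by apply/rowP => j; rewrite [RHS]mxE; apply/eqP; have := uB0 j; rewrite negbK.
  have uA : map_mx intr u *m A = 0.
    by rewrite AB -scalemxAr -map_mxM uB map_mx0 scaler0.
  have : row_free A by rewrite /row_free eqn_leq rank_leq_row.
  move/row_freeP => [A' AA']; apply/eqP/rowP => i.
  have /rowP/(_ i) : map_mx intr u = 0 :> 'rV[rat]_n.
    by rewrite -[LHS]mulmx1 -AA' mulmxA uA mul0mx.
  by rewrite !mxE => /eqP; rewrite intr_eq0 => /eqP.
rewrite (bigD1 j) //=; apply: (@le_trans _ _ (e 0 j)).
  rewrite -[leRHS]invrK lef_pV2 ?posrE ?invr_gt0 //.
  rewrite /S (bigD1 j) //= addrCA lerDl addr_ge0 //.
  by apply: sumr_ge0 => l _; rewrite invr_ge0 ltW.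
apply: (@le_trans _ _ (e 0 j * (map_mx intr (u *m B) : 'rV[R]_p) 0 j ^+ 2)); last first.
  by rewrite lerDl; apply: sumr_ge0 => l _; rewrite mulr_ge0 ?sqr_ge0 // ltW.
rewrite ler_pMr // mxE -rmorphXn /= -[1]/(1%:~R) ler_int.
by move: uBj; rewrite expr2; move: ((u *m B) 0 j) => m; nia.
Qed.

Lemma finite_gram_orbit p q (c0 : 'rV[R]_q) (A0 : 'M[rat]_(n, q))
    (A : 'M[rat]_(n, p)) :
  (forall j, 0 < c0 0 j) -> (n <= \rank A0)%N ->
  finite_set [set g : 'M[int]_n | \det g = 1 /\
    exists2 c : 'rV[R]_p, (forall j, 0 < c 0 j) &
      gram c (map_mx intr g *m A) = gram c0 A0].
Proof.
move=> c00 rA0; have [mu mu0 xmu] := gram_lattice_min c00 rA0.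
have [N N0 [B AB]] := clear_denominators A.
apply: sub_finite_set (finite_cone_orbit B mu0 xmu) => g [detg [c cpos gE]].
split=> //; exists (ratr (N%:R^-1) ^+ 2 *: c).
  by move=> j; rewrite mxE mulr_ge0 ?sqr_ge0 // ltW.
by rewrite -gE AB -scalemxAr -map_mxM gram_int.
Qed.

End Finiteness.

Lemma fsum_linear (T : choiceType) (I : finType) (G : set T) (a : I -> rat)
    (f : I -> T -> rat) :
  (forall i, finite_set [set g | G g /\ f i g != 0]) ->
  \sum_i a i * (\sum_(g \in G) f i g) = \sum_(g \in G) \sum_i a i * f i g.
Proof.
move=> ffin; pose S := \bigcup_i [set g | G g /\ f i g != 0].
have Sfin : finite_set S by apply: bigcup_finite => // ; exact: finite_finset.
have SG : S `<=` G by move=> g [i _ []].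
have out i g : (G `\` S) g -> f i g = 0.
  move=> [Gg nSg]; apply/eqP; apply: contrapT => /negP fg.
  by apply: nSg; exists i.
rewrite -(fsbig_widen S G) //; last first.
  by move=> g Sg /=; apply: big1 => i _; rewrite out ?mulr0.
rewrite fsbig_finite // exchange_big; apply: eq_bigr => i _.
rewrite -(fsbig_widen S G) => [|//|g Sg /=]; last by rewrite out.
by rewrite fsbig_finite // mulr_sumr.
Qed.

Section LiftFunctional.
Variables (K : fieldType) (V : lmodType K) (S : set V).
Variables (f : V -> K^o) (linf : linear f) (fS : forall x, S x -> f x = 0).

(** A linear form that kills the relations, on the quotient.  It is defined on
    representatives, like the maps between quotients. *)
Definition lquot_functional (x : lquot S) : K^o := f (lrepr x).

Let F : {linear V -> K^o} := HB.pack f (GRing.isLinear.Build K V K^o _ f linf).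

Lemma lquot_functionalE x : lquot_functional (lproj S x) = f x.
Proof.
apply/eqP; rewrite /lquot_functional -subr_eq0 -[f]/(F : V -> K^o) -linearB; apply/eqP.
have /eq_lproj[r rS ->] : lproj S (lrepr (lproj S x)) = lproj S x by exact: lreprK.
rewrite linear_sum big_seq big1 // => p pr.
by rewrite linearZ /= /F /= fS ?scaler0 //; exact: rS.
Qed.

Lemma lquot_functional_linear : linear lquot_functional.
Proof.
move=> a x y; rewrite -[x]lreprK -[y]lreprK -linearP !lquot_functionalE.
exact: linf.
Qed.

End LiftFunctional.

Section Degree.
Variables (R : realType) (n t : nat) (E : (t + n).-tuple 'M[R]_n).
Hypothesis hE : basis_of (symY R n) E.
Variable G : set 'M[int]_n.
Hypothesis hG : subgroup G (SLZ n).
Variable xi : 'rV[R]_(t + n).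
Hypothesis xi_generic : forall A : 'M[rat]_(n, (t + n).+1),
  in_general_position xi (frame E A).

Definition local_degree (A : 'M[rat]_(n, t + n)) (g : 'M[int]_n) : rat :=
  cone_index xi (frame E (map_mx intr g *m A)).

Hypothesis local_degree_finite : forall A,
  finite_set [set g | G g /\ local_degree A g != 0].

(** The number of translates of the cone of [A] by [G] that contain [xi], counted
    with orientation. *)
Definition degree (A : 'M[rat]_(n, t + n)) : rat :=
  \sum_(g \in G) local_degree A g.

Let G_unit g : G g -> (map_mx intr g : 'M[rat]_n) \in unitmx.
Proof.
have [GS _ _ _] := hG => /GS gS.
by rewrite unitmxE det_map_mx gS rmorph1 unitr1.
Qed.

Lemma degree_scale (a : rat) A B :
  (forall g, G g -> local_degree B g = a * local_degree A g) ->
  degree B = a * degree A.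
Proof.
move=> BA; have := @fsum_linear _ unit G (fun=> a) (fun=> local_degree A) (fun=> local_degree_finite A).
rewrite big_const card_unit /= addr0 => ->; apply: eq_fsbigr => g /set_mem Gg.
by rewrite big_const card_unit /= addr0 BA.
Qed.

Definition chain_degree : chain n t -> rat^o :=
  fglift (fun A : symbol n t => degree (val A) : rat^o).

Lemma chain_degreeU A : chain_degree << A >> = degree (val A).
Proof. by rewrite /chain_degree liftU scale1r. Qed.

Lemma chain_degree_linear : linear chain_degree.
Proof. exact: fglift_linear. Qed.

Let CD : {linear chain n t -> rat^o} :=
  HB.pack chain_degree (GRing.isLinear.Build _ _ _ _ _ chain_degree_linear).

(** The degree respects the three relations between symbols: a permutation
    changes the orientation, nonspanning columns give a degenerate cone, and
    scaling a column by [a] scales its rank one form by [a^2 > 0]. *)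
Lemma chain_degree_rel x : sharbly_rel x -> chain_degree x = 0.
Proof.
rewrite -[chain_degree]/(CD : _ -> _).
case=> [A B s AB|A rA|A B a a0 AB].
- rewrite linearB linearZ /CD /= !chain_degreeU AB; apply/eqP; rewrite subr_eq0; apply/eqP.
  apply: degree_scale => g _; rewrite /local_degree -cone_index_row_perm.
  by rewrite -frame_col_perm !col_permE mulmxA.
- rewrite /CD /= chain_degreeU; apply: fsbig1 => g Gg.
  apply: cone_index_eq0; apply: det_frame_nonspanning hE _ _.
  by apply: leq_ltn_trans (mxrankM_maxr _ _) rA.
- rewrite linearB /CD /= !chain_degreeU; apply/eqP; rewrite subr_eq0; apply/eqP.
  apply: eq_fsbigr => g _; rewrite /local_degree.
  pose b (j : 'I_(t + n)) : rat := if j == 0%N :> nat then a else 1.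
  rewrite (@frame_scale R n _ E _ (map_mx intr g *m val A) (map_mx intr g *m val B) b).
    rewrite cone_index_diag_mul // => i; rewrite mxE exprn_even_gt0 //=.
    by rewrite fmorph_eq0 /b; case: ifP; rewrite ?oner_eq0.
  move=> i j; rewrite !mxE mulr_sumr; apply: eq_bigr => l _.
  by rewrite AB mulrCA.
Qed.

Lemma chain_degree_boundary (x : chain n t.+1) : chain_degree (chain_boundary x) = 0.
Proof.
pose f (x : chain n t.+1) : rat^o := chain_degree (chain_boundary x).
apply: (@chain_ext _ _ f (fun=> 0)); rewrite /f.
- by move=> a y z; rewrite chain_boundary_linear chain_degree_linear.
- by move=> a y z; rewrite scaler0 addr0.
move=> A; rewrite chain_boundaryU -[chain_degree]/(CD : _ -> _) linear_sum.
transitivity (\sum_(j < (t + n).+1) (-1) ^+ j * degree (col' j (val A : 'M_(n, (t + n).+1)))).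
  by apply: eq_bigr => j _; rewrite linearZ /CD /= chain_degreeU.
rewrite fsum_linear; last by move=> j; exact: local_degree_finite.
apply: fsbig1 => g Gg.
pose gA : 'M[rat]_(n, (t + n).+1) := map_mx intr g *m val A.
have -> : \sum_(j < (t + n).+1) (-1) ^+ j *
    local_degree (col' j (val A : 'M_(n, (t + n).+1))) g =
  \sum_(j < (t + n).+1) (-1) ^+ j * cone_index xi (row' j (frame E gA)).
  apply: eq_bigr => j _; rewrite -frame_col' /local_degree; congr (_ * cone_index _ (frame _ _)).
  by apply/matrixP => i l; rewrite !mxE; apply: eq_bigr => m _; rewrite !mxE.
have H := @cone_index_boundary R (t + n) (frame E gA) xi (\col_j \tr (1%:M *m E`_j)).
apply: H; last exact: xi_generic.
move=> i.
apply: (frame_trace_gt0 hE).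
rewrite colE -mulmxA -colE; have /forallP/(_ i) := valP A; apply: contra_neq => Ei.
by rewrite -[LHS](mulKmx (G_unit Gg)) Ei mulmx0.
Qed.

Lemma degree_invariant (h : 'M[int]_n) A : G h -> degree (map_mx intr h *m A) = degree A.
Proof.
have [GS G1 GM GV] := hG => Gh.
have hU : h \in unitmx by rewrite unitmxE (GS _ Gh) unitr1.
rewrite /degree [RHS](@reindex_fsbig _ _ _ _ _ (fun g => g *m h) G G) //.
  by apply: eq_fsbigr => g _; rewrite /local_degree mulmxA -map_mxM.
split=> [g Gg|g1 g2 _ _ /(congr1 (mulmx^~ (invmx h)))|g Gg].
- exact: GM.
- by rewrite !mulmxK.
- by exists (g *m invmx h); [apply: GM => //; exact: GV | rewrite mulmxKV].
Qed.

Lemma chain_degree_act (g : GLQ n) h (x : chain n t) :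
  G h -> val g = map_mx intr h -> chain_degree (chain_act g x) = chain_degree x.
Proof.
move=> Gh gh; pose f (x : chain n t) : rat^o := chain_degree (chain_act g x).
apply: (@chain_ext _ _ f chain_degree); rewrite /f.
- by move=> a y z; rewrite chain_act_linear chain_degree_linear.
- exact: chain_degree_linear.
by move=> A; rewrite chain_actU !chain_degreeU /= gh degree_invariant.
Qed.

Definition Sh_degree : Sh n t -> rat^o := lquot_functional chain_degree.

Lemma Sh_degree_linear : linear Sh_degree.
Proof. exact: lquot_functional_linear chain_degree_linear chain_degree_rel. Qed.

Lemma Sh_degreeE x : Sh_degree (lproj _ x) = chain_degree x.
Proof. exact: lquot_functionalE chain_degree_linear chain_degree_rel x. Qed.

Lemma Sh_degree_coinvariant_rel x : coinvariant_rel G x -> Sh_degree x = 0.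
Proof.
move=> [h [g [y [Gh gh ->]]]].
pose F : {linear Sh n t -> rat^o} :=
  HB.pack Sh_degree (GRing.isLinear.Build _ _ _ _ _ Sh_degree_linear).
rewrite -[Sh_degree]/(F : _ -> _) linearB -[y]lreprK /F /=.
rewrite /Sh_act lquot_mapE; first last.
- by move=> x' rx'; exact: chain_act_rel.
- exact: chain_act_linear.
by rewrite !Sh_degreeE (chain_degree_act _ Gh gh) subrr.
Qed.

Definition coinv_degree : coinvariants G t -> rat^o := lquot_functional Sh_degree.

Lemma coinv_degree_linear : linear coinv_degree.
Proof. exact: lquot_functional_linear Sh_degree_linear Sh_degree_coinvariant_rel. Qed.

Lemma coinv_degreeE x : coinv_degree (lproj _ x) = Sh_degree x.
Proof. exact: lquot_functionalE Sh_degree_linear Sh_degree_coinvariant_rel x. Qed.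

Lemma coinv_degree_class A : coinv_degree (sharbly_class G A) = degree (val A).
Proof. by rewrite coinv_degreeE Sh_degreeE chain_degreeU. Qed.

Lemma coinv_degree_boundary (w : coinvariants G t.+1) :
  coinv_degree (coinv_boundary w) = 0.
Proof.
rewrite -[w]lreprK coinv_boundaryE coinv_degreeE -[lrepr w]lreprK /=.
rewrite lquot_mapE; first last.
- by move=> x' rx'; exact: chain_boundary_rel.
- exact: chain_boundary_linear.
by rewrite Sh_degreeE chain_degree_boundary.
Qed.

(** The translates of a positively oriented cone are positively oriented. *)
Lemma local_degree_ge0 A g : G g -> 0 < \det (frame E A) -> 0 <= local_degree A g.
Proof.
have [GS _ _ _] := hG => Gg A0.
rewrite /local_degree /cone_index; case: ifP => // _.
rewrite (frame_mul hE) det_mulmx mulr_gt0 // det_sym_action_gt0 //.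
have -> : map_mx ratr (map_mx intr g) = map_mx intr g :> 'M[R]_n.
  by apply/matrixP => i j; rewrite !mxE ratr_int.
by rewrite det_map_mx (GS _ Gg) rmorph1.
Qed.

Let support_finite A : finite_set (G `&` local_degree A @^-1` [set~ 0]).
Proof. by apply: sub_finite_set (local_degree_finite A) => g [Gg /eqP]. Qed.

Lemma degree_ge0 A : 0 < \det (frame E A) -> 0 <= degree A.
Proof.
move=> A0; rewrite /degree fsbig_supp fsbig_finite //.
rewrite big_seq; apply: sumr_ge0 => g; rewrite in_fset_set //.
by move=> /set_mem[Gg _]; exact: local_degree_ge0.
Qed.

Lemma degree_gt0 A (c : 'rV[R]_(t + n)) : 0 < \det (frame E A) -> (forall j, 0 < c 0 j) ->
  c *m frame E A = xi -> 0 < degree A.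
Proof.
move=> A0 c0 cA; have [_ G1 _ _] := hG.
have one : local_degree A 1%:M = 1.
  rewrite /local_degree map_mx1 mul1mx /cone_index A0 ifT //.
  by apply/in_open_coneP; split; [rewrite unitmxE unitfE gt_eqF | exists c].
rewrite /degree fsbig_supp (fsbigD1 1%:M) //=; last first.
  by split=> //; rewrite /preimage /= one; apply/eqP; exact: oner_neq0.
have fin := finite_setD [set 1%:M] (support_finite A).
rewrite one ltr_pwDl // fsbig_finite //.
rewrite big_seq; apply: sumr_ge0 => g; rewrite in_fset_set //.
by move=> /set_mem[[Gg _] _]; exact: local_degree_ge0.
Qed.

End Degree.

(** * The Voronoi cycle *)

Lemma group_index_gt0 n (D G : set 'M[int]_n) :
  G 1%:M -> finite_index D G -> (0 < group_index D G)%N.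
Proof.
move=> G1 fin; rewrite /group_index cardfs_gt0; apply/fset0Pn.
exists [set 1%:M *m h | h in D]; rewrite in_fset_set //; apply/mem_set.
by exists 1%:M.
Qed.

(** An affine subspace of dimension [d - 2] lies in a linear one of dimension
    [d - 1], so the cone of a flipon is degenerate. *)
Lemma flipon_det0 (R : realType) n (E : (tdeg n + n).-tuple 'M[R]_n)
    (A : symbol n (tdeg n)) : (2 <= n)%N -> basis_of (symY R n) E ->
  flipon R A -> \det (frame E (val A)) = 0.
Proof.
move=> hn hE [p [V [pY VY dV AV]]].
apply: (det_frame_in_subspace hE (U := (<[p]> + V)%VS)).
  apply: leq_ltn_trans (dimv_add_leqif _ _) _.
  rewrite dV dim_vline; case: (p != 0); lia.
by move=> j; rewrite -(subrK p (rank_one R _)) addrC memv_add ?memv_line.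
Qed.

(** Some tile has a representative, and its triangulation is not empty since it
    covers the tile, which contains [0]. *)
Lemma voronoi_cycle_has_cone (R : realType) n (D : set 'M[int]_n)
    (RD : set (set 'M[R]_n)) (tri : set 'M[R]_n -> set (set 'M[R]_n)) :
  orbit_representatives D RD -> (forall T, RD T -> triangulation T (tri T)) ->
  (\bigcup_(T in RD) tri T) !=set0.
Proof.
move=> [RDtile RDrep] triP; have [T0 /RDrep[T [[RDT _] _]]] := tile_exists R n.
have [_ TE _] := triP T RDT; have [s Ks _] : (\bigcup_(s in tri T) s) 0.
  rewrite -TE; have [q [m [V [_ _ _ ->]]]] := RDtile T RDT.
  by exists (fun=> 0) => //; rewrite big1 // => j _; rewrite scale0r.
by exists s, T.
Qed.

Section Cycle.
Variables (n k : nat) (D G : set 'M[int]_n).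

Lemma coinv_boundary_scale_iota (a : rat) (z : coinvariants D k) : D `<=` G ->
  coinv_boundary z = 0 -> coinv_boundary (a *: coinv_iota G z) = 0.
Proof.
move=> DG; rewrite -[z]lreprK coinv_boundaryE => bz.
have iota0 : coinv_iota G (0 : coinvariants D k.-1) = 0.
  have lproj0 : lproj (@coinvariant_rel n D k.-1) 0 = 0 := linear0 _.
  by rewrite -lproj0 coinv_iotaE // linear0.
rewrite coinv_iotaE // -linearZ coinv_boundaryE.
pose F : {linear Sh n k -> Sh n k.-1} :=
  HB.pack (@Sh_boundary n k) (GRing.isLinear.Build _ _ _ _ _ (@Sh_boundary_linear n k)).
rewrite -[@Sh_boundary n k]/(F : _ -> _) linearZ linearZ /F /=.
by rewrite -(coinv_iotaE (Sh_boundary (lrepr z)) DG) bz iota0 scaler0.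
Qed.

End Cycle.

Theorem corollary6p3 (R : realType) (n : nat) (hn : (2 <= n)%N)
    (E : (tdeg n + n).-tuple 'M[R]_n) (hE : basis_of (symY R n) E)
    (H : set 'M[R]_n) (hH : section_hyperplane H)
    (G : set 'M[int]_n) (hG : subgroup G (SLZ n)) (hGfin : finite_index G (SLZ n))
    (D : set 'M[int]_n) (hD : subgroup D G) (hDnormal : normal_in D G)
    (hDfin : finite_index D G) (hDtf : torsionfree D)
    (zD : coinvariants D (tdeg n)) (hzD : voronoi_cycle E H zD) :
  nonzero_homology_class ((group_index D G)%:R^-1 *: coinv_iota G zD).
Proof.
have [GS G1 _ _] := hG; have [DG _ _ _] := hD.
have [RD [tri [As [Fs [repRD triRD [_ _ posAs coneAs] flipFs [zE bz]]]]]] := hzD.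
split; first exact: coinv_boundary_scale_iota.
have [A0 A0As] : exists A0, A0 \in As.
  have [s] := voronoi_cycle_has_cone repRD (fun T RDT => (triRD T RDT).1).
  by rewrite coneAs => -[A0 A0As _]; exists A0.
have A0unit : frame E (val A0) \in unitmx.
  by rewrite unitmxE unitfE gt_eqF //; exact: posAs.
have rA0 : (n <= \rank (val A0))%N.
  rewrite leqNgt; apply: contraTN A0unit => /(det_frame_nonspanning hE) d0.
  by rewrite unitmxE d0 unitr0.
have [c c0 gen] := exists_general_position
  (fun A : 'M[rat]_(n, (tdeg n + n).+1) => frame E A) A0unit.
(* A generic point inside the cone of [A0], at which the degree is taken. *)
pose xi := c *m frame E (val A0).
have fin A : finite_set [set g | G g /\ local_degree E xi A g != 0].
  apply: sub_finite_set (finite_gram_orbit A c0 rA0) => g [Gg].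
  rewrite /local_degree /cone_index; case: ifP => [|_]; last by rewrite eqxx.
  move=> /in_open_coneP[_ [c' c'0 c'E]] _; split; first exact: GS.
  exists c' => //; apply: (sym_coords_inj hE); rewrite ?gram_sym //.
  by rewrite -!mul_frame.
move=> [w wE].
have := coinv_degree_boundary hE hG gen fin w; rewrite wE.
pose F : {linear coinvariants G (tdeg n) -> rat^o} :=
  HB.pack (coinv_degree E xi) (GRing.isLinear.Build _ _ _ _ _
    (coinv_degree_linear hE hG fin)).
rewrite -[coinv_degree E xi]/(F : _ -> _) linearZ.
have -> : coinv_iota G zD =
    \sum_(A <- As) sharbly_class G A + \sum_(A <- Fs) sharbly_class G A.
  rewrite zE /sharbly_class -!linear_sum -linearD coinv_iotaE //.
  by rewrite linearD !linear_sum.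
rewrite linearD !linear_sum /F /=.
under eq_bigr do rewrite (coinv_degree_class hE hG fin).
under [X in _ + X]eq_bigr do rewrite (coinv_degree_class hE hG fin).
rewrite [X in _ + X]big_seq [X in _ + X]big1 => [|A /flipFs AF]; last first.
  apply: fsbig1 => g Gg; apply: cone_index_eq0.
  by rewrite (frame_mul hE) det_mulmx (flipon_det0 hn hE AF) mul0r.
rewrite addr0; apply/eqP; rewrite gt_eqF //.
rewrite /GRing.scale /= mulr_gt0 //.
  by rewrite invr_gt0 ltr0n group_index_gt0.
rewrite (big_rem A0) //= ltr_pwDl //.
  exact: (degree_gt0 hE hG fin (posAs _ A0As) c0).
rewrite big_seq; apply: sumr_ge0 => A /mem_rem /posAs Apos.
exact: (degree_ge0 hE hG fin).
Qed.
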